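(* Let $(X,T^{1,0}X)$ be a compact and orientable CR manifold of dimension $2n+1+d$ and codimension $d+1$, $d\geq1$, $n\geq2$, with a CR action of a $d$-dimensional compact Lie group $G$. Let $T\in C^\infty(X,TX)$ be such that $\mathbb{C}TX=T^{1,0}X\oplus T^{0,1}X\oplus\mathbb{C}T\oplus\mathbb{C}\underline{\mathfrak g}$, and assume that $X$ is strongly pseudoconvex in the direction of $T$. Let $f_1,\dots,f_N\in H^0_{b,G}(X)$ be such that $F=(f_1,\dots,f_N)\colon X\to\mathbb{C}^N$ is an embedding. Let $W:=\mathrm{span}\bigcup_{j=1}^NGf_j\subset H^0_b(X)$ be the (finite-dimensional) span of the $G$-orbits of the $f_j$, let $M=\dim_{\mathbb{C}}W$, and identify $W^*\cong\mathbb{C}^M$. Then the map $\hat F\colon X\to W^*\cong\mathbb{C}^M$, $x\mapsto(h\mapsto h(x))$, is a $G$-equivariant CR map which is an embedding.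
   Context: A CR structure on a manifold $X$ of dimension $2n+1+d$ (codimension $d+1$) is a complex subbundle $T^{1,0}X\subset\mathbb{C}TX$ of rank $n$ with $T^{1,0}X\cap T^{0,1}X=\{0\}$, $T^{0,1}X:=\overline{T^{1,0}X}$, and $[\mathcal V,\mathcal V]\subset\mathcal V$ where $\mathcal V=C^\infty(X,T^{1,0}X)$. For $\xi\in\mathfrak g$ (the Lie algebra of $G$), $\xi_X$ is the induced vector field $(\xi_Xu)(x)=\frac{\partial}{\partial t}u(e^{t\xi}\circ x)|_{t=0}$, and $\underline{\mathfrak g}=\mathrm{span}(\xi_X;\xi\in\mathfrak g)$. The action of $G$ is CR: $dg(T^{1,0}X)= T^{1,0}X$ for every $g\in G$; in particular $[\xi_X,\mathcal V]\subset\mathcal V$ for every $\xi\in\mathfrak g$. Let $\omega_0$ be the real one-form on $X$ with $\omega_0=0$ on $T^{1,0}X\oplus T^{0,1}X\oplus\mathbb{C}\underline{\mathfrak g}$ and $\langle\omega_0,T\rangle=-1$. $X$ is strongly pseudoconvex in the direction of $T$ if $\mathcal L_{\omega_0,x}(U,V)=-\frac{1}{2i}\langle d\omega_0(x),U\wedge\overline V\rangle$, $U,V\in T^{1,0}_xX$, is positive definite at every $x\in X$. Let $\{\mathcal R_m;\,m=1,2,\dots\}$ be the irreducible unitary representations of $G$, one from each equivalence class, $d_m=\dim\mathcal R_m$, $\chi_m=\mathrm{Tr}\,\mathcal R_m$, and $d\mu$ the normalized Haar measure. For $u\in C^\infty(X)$ put $u_m(x)=d_m\int_G u(g\circ x)\overline{\chi_m(g)}\,d\mu(g)$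 and $C^\infty_m(X)=\{F_m;\,F\in C^\infty(X)\}$. A function $f\in C^\infty(X)$ is $G$-finite if it is a finite sum of elements of spaces $C^\infty_{m_j}(X)$; the set of these is $C^\infty_G(X)$. $H^0_b(X)$ is the space of smooth CR functions ($\overline Zu=0$ for all $Z\in C^\infty(X,T^{1,0}X)$), and $H^0_{b,G}(X)=H^0_b(X)\cap C^\infty_G(X)$. $G$ acts on $H^0_b(X)$ by $(gf)(x)=f(g^{-1}x)$, and on duals by $(g\lambda)(f)=\lambda(g^{-1}f)$. A smooth map $\hat F\colon X\to\mathbb{C}^M$ is a CR map if $d\hat F(T^{1,0}X)\subset T^{1,0}\mathbb{C}^M$, i.e. its components are CR functions. Embedding means smooth embedding. *)

(* Defs.v *)
(** Throughout, [R : realType] is the real line and [R[i]] the complex numbers.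

    Tangent vectors are derivations: a complex tangent vector at [x] is a
    [C]-linear derivation at [x] of the algebra of complex-valued smooth
    functions.  So that equality of tangent vectors is Leibniz equality, they
    are represented as functionals on all functions [X -> R[i]], with value 0 on
    the functions that are not smooth.  The same device is used for the dual of
    a space of functions. *)
From HB Require Import structures.
From mathcomp Require Import all_boot all_order all_algebra.
From mathcomp Require Import all_classical all_reals all_analysis.
From mathcomp Require Import complex.

Set Implicit Arguments.
Unset Strict Implicit.
Unset Printing Implicit Defensive.

Import Order.TTheory GRing.Theory Num.Theory.
Import numFieldNormedType.Exports.

Local Open Scope classical_set_scope.
Local Open Scope ring_scope.

(** The compatibility of the two structures is part of [lie_group]; the base
    point is arbitrary and only needed to form the Borel sigma-algebra. *)
#[short(type="topGroupType")]
HB.structure Definition TopGroup := {G of PointedTopological G & Group G}.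

Section LinearAlgebra.
Context {R : realType} {T : Type}.
Implicit Type S : set (T -> R[i]).

Definition lcomb k (c : 'I_k -> R[i]) (s : 'I_k -> T -> R[i]) : T -> R[i] :=
  fun t => \sum_(i < k) c i * s i t.

Definition cspan S : set (T -> R[i]) :=
  [set w | exists k (c : 'I_k -> R[i]) (s : 'I_k -> T -> R[i]),
    (forall i, S (s i)) /\ w = lcomb c s].

Definition is_basis S k (s : 'I_k -> T -> R[i]) : Prop :=
  (forall c, lcomb c s = 0 -> forall i, c i = 0) /\ cspan (range s) = S.

Definition has_dim S (k : nat) : Prop :=
  exists s : 'I_k -> T -> R[i], is_basis S s.

Definition direct_sum4 S (E1 E2 E3 E4 : set (T -> R[i])) : Prop :=
  (forall v, S v <-> exists v1 v2 v3 v4,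
      [/\ E1 v1, E2 v2, E3 v3, E4 v4 & v = v1 + v2 + v3 + v4]) /\
  (forall v1 v2 v3 v4, E1 v1 -> E2 v2 -> E3 v3 -> E4 v4 ->
      v1 + v2 + v3 + v4 = 0 -> [/\ v1 = 0, v2 = 0, v3 = 0 & v4 = 0]).

(** The linear functionals on [S], extended by 0 outside [S]. *)
Definition dual S : set ((T -> R[i]) -> R[i]) :=
  [set l | (forall a h k, S h -> S k ->
              l (fun t => a * h t + k t) = a * l h + l k)
        /\ (forall h, ~ S h -> l h = 0)].

(** [Phi] restricts to a linear isomorphism from [S] onto [C^M]. *)
Definition linear_iso S M (Phi : (T -> R[i]) -> 'rV[R[i]]_M) : Prop :=
  [/\ forall a l k, S l -> S k ->
        Phi (fun t => a * l t + k t) = a *: Phi l + Phi k,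
      forall l k, S l -> S k -> Phi l = Phi k -> l = k
    & forall z, exists2 l, S l & Phi l = z].

End LinearAlgebra.

Section Smoothness.
Context {R : realType} {V W : normedModType R}.

(** For an open set [U]. *)
Fixpoint Ck (k : nat) (U : set V) (f : V -> W) : Prop :=
  if k is k'.+1 then
    (forall x, U x -> differentiable f x) /\ (forall v, Ck k' U ('D_v f))
  else forall x, U x -> {for x, continuous f}.

Definition smooth_on (U : set V) (f : V -> W) : Prop := forall k, Ck k U f.

End Smoothness.

Record chart (R : realType) (X : topologicalType) (m : nat) := Chart {
  cdom : set X;
  cfun : X -> 'rV[R]_m;
  cinv : 'rV[R]_m -> X }.

Section Manifolds.
Context {R : realType} {X : topologicalType} {m : nat}.
Implicit Types (c d : chart R X m) (A : set (chart R X m)).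

Definition is_chart c : Prop :=
  [/\ open (cdom c), open (cfun c @` cdom c),
      forall x, cdom c x -> cinv c (cfun c x) = x,
      forall x, cdom c x -> {for x, continuous (cfun c)}
    & forall p, (cfun c @` cdom c) p -> {for p, continuous (cinv c)}].

Definition transition c d : 'rV[R]_m -> 'rV[R]_m := cfun d \o cinv c.

Definition overlap c d : set 'rV[R]_m := cfun c @` (cdom c `&` cdom d).

Definition smooth_atlas A : Prop :=
  [/\ forall c, A c -> is_chart c,
      forall x, exists2 c, A c & cdom c x
    & forall c d, A c -> A d -> smooth_on (overlap c d) (transition c d)].

Definition smooth_manifold A : Prop :=
  [/\ hausdorff_space X, @second_countable X & smooth_atlas A].

Definition orientable A : Prop :=
  exists B : set (chart R X m),
    [/\ smooth_atlas B, smooth_atlas (A `|` B)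
      & forall c d, B c -> B d -> forall p, overlap c d p ->
          0 < \det ('J (transition c d) p)].

Definition smooth_fun A (f : X -> R[i]) : Prop :=
  forall c, A c ->
    smooth_on (cfun c @` cdom c) (fun p => complex.Re (f (cinv c p)) : R) /\
    smooth_on (cfun c @` cdom c) (fun p => complex.Im (f (cinv c p)) : R).

End Manifolds.

Definition smooth_map (R : realType) (X Y : topologicalType) (m p : nat)
    (A : set (chart R X m)) (B : set (chart R Y p)) (f : X -> Y) : Prop :=
  continuous f /\
  forall c d, A c -> B d ->
    smooth_on (cfun c @` (cdom c `&` f @^-1` cdom d)) (cfun d \o f \o cinv c).

Definition prod_chart (R : realType) (X Y : topologicalType) (m p : nat)
    (c : chart R X m) (d : chart R Y p) : chart R (X * Y)%type (m + p) :=
  Chart (cdom c `*` cdom d)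
        (fun z => row_mx (cfun c z.1) (cfun d z.2))
        (fun v => (cinv c (lsubmx v), cinv d (rsubmx v))).

Definition prod_atlas (R : realType) (X Y : topologicalType) (m p : nat)
    (A : set (chart R X m)) (B : set (chart R Y p)) :
    set (chart R (X * Y)%type (m + p)) :=
  [set prod_chart c d | c in A & d in B].

Definition real_line (R : realType) : set (chart R R 1) :=
  [set Chart setT (fun t => const_mx t) (fun v => v 0 0)].
Arguments real_line R : clear implicits.

Definition euclidean_space (R : realType) (k : nat) :
    set (chart R 'rV[R]_k k) := [set Chart setT id id].
Arguments euclidean_space R k : clear implicits.

Section Tangent.
Context {R : realType} {X : topologicalType} {m : nat}.
Variable A : set (chart R X m).
Local Notation functional := ((X -> R[i]) -> R[i]).
Implicit Types (v : functional) (Z Y : X -> functional).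

Definition ctangent (x : X) : set functional :=
  [set v | [/\ forall a f g, smooth_fun A f -> smooth_fun A g ->
                 v (fun y => a * f y + g y) = a * v f + v g,
               forall f g, smooth_fun A f -> smooth_fun A g ->
                 v (fun y => f y * g y) = f x * v g + v f * g x
             & forall f, ~ smooth_fun A f -> v f = 0]].

Definition vconj v : functional := fun f => ((v (fun y => (f y)^*%C))^*)%C.

Definition rtangent (x : X) : set functional :=
  [set v | ctangent x v /\ vconj v = v].

Definition smooth_field Z : Prop :=
  (forall x, ctangent x (Z x)) /\
  (forall f, smooth_fun A f -> smooth_fun A (fun x => Z x f)).

Definition real_smooth_field Z : Prop :=
  smooth_field Z /\ forall x, rtangent x (Z x).

Definition bracket Z Y : X -> functional :=
  fun x f => Z x (fun y => Y y f) - Y x (fun y => Z y f).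

Definition bundle_section (E : X -> set functional) Z : Prop :=
  smooth_field Z /\ forall x, E x (Z x).

Definition one_form (w : X -> functional -> R[i]) : Prop :=
  (forall x a u v, ctangent x u -> ctangent x v ->
     w x (fun f => a * u f + v f) = a * w x u + w x v) /\
  (forall Z, smooth_field Z -> smooth_fun A (fun x => w x (Z x))).

(** [d w (Z, Y) = Z (w Y) - Y (w Z) - w [Z, Y]]. *)
Definition ext_deriv (w : X -> functional -> R[i]) Z Y (x : X) : R[i] :=
  Z x (fun y => w y (Y y)) - Y x (fun y => w y (Z y)) - w x (bracket Z Y x).

End Tangent.

Section Differential.
Context {R : realType} {X Y : topologicalType} {m p : nat}.
Variables (A : set (chart R X m)) (B : set (chart R Y p)).

Definition pushforward (f : X -> Y) (v : (X -> R[i]) -> R[i]) :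
    (Y -> R[i]) -> R[i] :=
  fun phi => if `[< smooth_fun B phi >] then v (phi \o f) else 0.

Definition immersion (f : X -> Y) : Prop :=
  forall x v, rtangent A x v -> pushforward f v = 0 -> v = 0.

Definition topological_embedding (f : X -> Y) : Prop :=
  [/\ continuous f, injective f
    & forall U, open U -> exists2 V, open V & U = f @^-1` V].

Definition smooth_embedding (f : X -> Y) : Prop :=
  [/\ smooth_map A B f, immersion f & topological_embedding f].

End Differential.

Section CR.
Context {R : realType} {X : topologicalType} {m : nat}.
Variable A : set (chart R X m).
Local Notation functional := ((X -> R[i]) -> R[i]).
Implicit Type E : X -> set functional.

(** Local frames may be taken to be globally defined, by multiplying with a
    cutoff function. *)
Definition complex_subbundle (n : nat) E : Prop :=
  forall x, exists (U : set X) (Z : 'I_n -> X -> functional),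
    [/\ open U, U x, forall i, smooth_field A (Z i)
      & forall y, U y -> is_basis (E y) (fun i => Z i y)].

Definition conj_bundle E : X -> set functional :=
  fun x => [set vconj v | v in E x].

Definition CR_structure (n : nat) (T10 : X -> set functional) : Prop :=
  [/\ complex_subbundle n T10,
      forall x, T10 x `&` conj_bundle T10 x = [set 0]
    & forall Z Y, bundle_section A T10 Z -> bundle_section A T10 Y ->
        bundle_section A T10 (bracket Z Y)].

Definition CR_function (T10 : X -> set functional) : set (X -> R[i]) :=
  [set u | smooth_fun A u /\
     forall Z, bundle_section A T10 Z -> forall x, vconj (Z x) u = 0].

(** The Levi form of [w] on sections of [T10]. *)
Definition levi_form (w : X -> functional -> R[i])
    (U V : X -> functional) (x : X) : R[i] :=
  - (2%:R * 'i%C)^-1 * ext_deriv w U (fun y => vconj (V y)) x.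

(** Every vector of [T10 x] is the value at [x] of a section, and the Levi form
    at [x] depends on the values at [x] only. *)
Definition levi_positive (T10 : X -> set functional)
    (w : X -> functional -> R[i]) : Prop :=
  forall x U, bundle_section A T10 U -> U x <> 0 -> 0 < levi_form w U U x.

End CR.

Definition CR_map (R : realType) (X Y : topologicalType) (m p : nat)
    (A : set (chart R X m)) (T10 : X -> set ((X -> R[i]) -> R[i]))
    (B : set (chart R Y p)) (S10 : Y -> set ((Y -> R[i]) -> R[i]))
    (f : X -> Y) : Prop :=
  smooth_map A B f /\
  forall x v, T10 x v -> S10 (f x) (pushforward B f v).

(** [C^M] is the manifold [R^(2M)] with complex coordinates
    [z_j = p_j + i p_(M+j)]; its (1,0) tangent vectors are those on which the
    forms [d (conj z_j)] vanish. *)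
Section ComplexSpace.
Context {R : realType} {M : nat}.

Definition realify (z : 'rV[R[i]]_M) : 'rV[R]_(M + M) :=
  row_mx (\row_j complex.Re (z 0 j)) (\row_j complex.Im (z 0 j)).

Definition zcoord (j : 'I_M) (p : 'rV[R]_(M + M)) : R[i] :=
  (p 0 (lshift M j) +i* p 0 (rshift M j))%C.

Definition Cspace : set (chart R 'rV[R]_(M + M) (M + M)) :=
  euclidean_space R (M + M).

Definition Cspace_T10 (p : 'rV[R]_(M + M)) :
    set (('rV[R]_(M + M) -> R[i]) -> R[i]) :=
  [set v | ctangent Cspace p v /\
           forall j, v (fun q => (zcoord j q)^*%C) = 0].

End ComplexSpace.
Arguments Cspace {R} M.
Arguments Cspace_T10 {R} M.

Section LieGroups.
Context {R : realType} {G : topGroupType} {d : nat}.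
Variable B : set (chart R G d).

Definition lie_group : Prop :=
  [/\ smooth_manifold B,
      smooth_map (prod_atlas B B) B (fun z : G * G => (z.1 * z.2)%g)
    & smooth_map B B (fun g : G => (g^-1)%g)].

Definition cderiv0 (f : R -> R[i]) : R[i] :=
  (derive1 (fun t => complex.Re (f t) : R) 0
   +i* derive1 (fun t => complex.Im (f t) : R) 0)%C.

(** [gamma t = exp (t xi)] for [xi] in the Lie algebra, the tangent space at
    the identity. *)
Definition exp_curve (xi : (G -> R[i]) -> R[i]) (gamma : R -> G) : Prop :=
  [/\ smooth_map (real_line R) B gamma,
      forall s t, gamma (s + t) = (gamma s * gamma t)%g
    & forall f, smooth_fun B f -> xi f = cderiv0 (f \o gamma)].

End LieGroups.

Section Actions.
Context {R : realType} {G : topGroupType} {X : topologicalType} {d m : nat}.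
Variables (B : set (chart R G d)) (A : set (chart R X m)) (act : G -> X -> X).
Local Notation functional := ((X -> R[i]) -> R[i]).

Definition smooth_action : Prop :=
  [/\ smooth_map (prod_atlas B A) A (fun z : G * X => act z.1 z.2),
      forall x, act 1%g x = x
    & forall g h x, act (g * h)%g x = act g (act h x)].

Definition CR_action (T10 : X -> set functional) : Prop :=
  smooth_action /\
  forall g x, [set pushforward A (act g) v | v in T10 x] = T10 (act g x).

(** The induced vector field [xi_X], for [gamma t = exp (t xi)]. *)
Definition induced_field (gamma : R -> G) (x : X) : functional :=
  fun u => if `[< smooth_fun A u >]
           then cderiv0 (fun t => u (act (gamma t) x)) else 0.

Definition orbit_directions (x : X) : set functional :=
  [set v | exists xi gamma,
     [/\ rtangent B 1%g xi, exp_curve B xi gamma & v = induced_field gamma x]].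

(** [w] is the real one-form [omega_0] determined by [T10], [T] and the
    action. *)
Definition is_omega0 (T10 : X -> set functional) (T : X -> functional)
    (w : X -> functional -> R[i]) : Prop :=
  [/\ one_form A w,
      forall x v, ctangent A x v -> w x (vconj v) = ((w x v)^*)%C,
      forall x v, (T10 x `|` conj_bundle T10 x `|` cspan (orbit_directions x)) v
        -> w x v = 0
    & forall x, w x (T x) = -1].

Definition strongly_pseudoconvex (T10 : X -> set functional)
    (T : X -> functional) : Prop :=
  exists w, is_omega0 T10 T w /\ levi_positive A T10 w.

Definition translate (g : G) (f : X -> R[i]) : X -> R[i] :=
  fun x => f (act (g^-1)%g x).

Definition dual_translate (g : G) (l : functional) : functional :=
  fun f => l (translate (g^-1)%g f).

Definition orbit_span N (f : 'I_N -> X -> R[i]) : set (X -> R[i]) :=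
  cspan [set translate g (f j) | g in [set: G] & j in [set: 'I_N]].

(** [h |-> h x], as an element of [dual W]. *)
Definition evaluation (W : set (X -> R[i])) (x : X) : functional :=
  fun h => if `[< W h >] then h x else 0.

End Actions.

Section Representations.
Context {R : realType} {G : topGroupType}.

(** Irreducibility is about the action on column vectors, hence the
    transposes. *)
Definition irreducible_unitary_rep k (rho : G -> 'M[R[i]]_k) : Prop :=
  [/\ (0 < k)%N,
      rho 1%g = 1%:M /\ forall g h, rho (g * h)%g = rho g *m rho h,
      forall g, rho g \is unitarymx,
      forall i j, continuous (fun g => complex.Re (rho g i j) : R) /\
                  continuous (fun g => complex.Im (rho g i j) : R)
    & forall U : 'M[R[i]]_k, (forall g, stablemx U (rho g)^T) ->
        U = 0 \/ row_full U].

Definition equivalent_rep k l (rho : G -> 'M[R[i]]_k) (sigma : G -> 'M[R[i]]_l)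
    : Prop :=
  exists P : 'M[R[i]]_(k, l),
    [/\ row_free P, row_full P & forall g, rho g *m P = P *m sigma g].

(** One representative of each equivalence class, indexed from 0. *)
Definition complete_irreps (dm : nat -> nat)
    (Rm : forall m, G -> 'M[R[i]]_(dm m)) : Prop :=
  [/\ forall m, irreducible_unitary_rep (Rm m),
      forall m m', equivalent_rep (Rm m) (Rm m') -> m = m'
    & forall k (rho : G -> 'M[R[i]]_k), irreducible_unitary_rep rho ->
        exists m, equivalent_rep rho (Rm m)].

Definition borel_type := g_sigma_algebraType (@open G).

(** On a compact group the left Haar measure is also right invariant; the
    normalization is part of the type [probability]. *)
Definition haar_measure (mu : probability borel_type R) : Prop :=
  forall (E : set borel_type) (g : G), measurable E ->
    mu [set (g * h : G)%g | h in E] = mu E /\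
    mu [set (h * g : G)%g | h in E] = mu E.

Definition cintegral (mu : probability borel_type R) (f : G -> R[i]) : R[i] :=
  (\int[mu]_(g in setT) complex.Re (f g)
   +i* \int[mu]_(g in setT) complex.Im (f g))%C.

Context {X : topologicalType} {m : nat}.
Variables (A : set (chart R X m)) (act : G -> X -> X).
Variable mu : probability borel_type R.

Definition fourier_component k (rho : G -> 'M[R[i]]_k) (u : X -> R[i]) :
    X -> R[i] :=
  fun x => k%:R * cintegral mu (fun g => u (act g x) * ((\tr (rho g))^*)%C).

Definition isotypic k (rho : G -> 'M[R[i]]_k) : set (X -> R[i]) :=
  [set fourier_component rho u | u in smooth_fun A].

Definition G_finite (dm : nat -> nat) (Rm : forall m, G -> 'M[R[i]]_(dm m)) :
    set (X -> R[i]) :=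
  [set f | smooth_fun A f /\
     exists k (mj : 'I_k -> nat) (h : 'I_k -> X -> R[i]),
       (forall j, isotypic (Rm (mj j)) (h j)) /\
       f = fun x => \sum_(j < k) h j x].

End Representations.

(* Main.v *)
Require Import Defs.
From HB Require Import structures.
From mathcomp Require Import all_boot all_order all_algebra.
From mathcomp Require Import all_classical all_reals all_analysis.
From mathcomp Require Import measurable_realfun complex ring lra.

Set Implicit Arguments.
Unset Strict Implicit.
Unset Printing Implicit Defensive.

Import Order.TTheory GRing.Theory Num.Theory.
Import numFieldNormedType.Exports.

Local Open Scope classical_set_scope.
Local Open Scope ring_scope.

(** Let [h_1, ..., h_M] be the coordinates of the evaluation map
    [Fhat : x |-> (h |-> h x)] of the space [W] spanned by the [G]-orbits of the
    functions [f_j].  Three facts make [Fhat] an equivariant CR embedding.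

    First, [W] is finite-dimensional ([orbit_span_has_dim]).  A [G]-finite
    function is a sum of Fourier components
    [w(x) = d \int u(g x) conj(tr (rho g)) dmu(g)].  Since the Haar measure is
    right invariant, [w(k^-1 x) = d \int u(g x) conj(tr (rho (g k))) dmu(g)],
    and [tr (rho (g k)) = \sum_(a, b) rho_ab(g) rho_ba(k)].  Hence every
    translate of [w] is a combination of the finitely many functions
    [x |-> \int u(g x) conj(rho_ab(g)) dmu(g)] ([translate_fourier_component]).

    Second, [W] consists of CR functions.  CR functions form a vector space, and
    the action preserves them because it maps sections of [T10] to sections of
    [T10] ([CR_comp]).  Expanding [Fhat x] in the basis of the dual of [W] that
    is dual to a basis of [W] shows that each [h_k] lies in [W]
    ([evaluation_coord_in]), so [Fhat] is smooth and its coordinates are CR.  A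
    CR function is defined by testing it against global sections of [T10], so
    that passing to a single tangent vector requires extending the vector to a
    section ([exists_section]); this is done with a smooth cutoff function built
    from [exp (-1/t)] ([smooth_bump]).

    Third, [W] contains the [f_j], so that each [f_j] is a linear combination of
    the [h_k] ([evaluation_coord_span]) and [F = L \o Fhat] with [L] linear.
    As [F] separates points, tangent vectors and open sets, so does [Fhat]
    ([smooth_embedding_factor]).

    Smoothness of all the functions above reduces to the fact that C^k maps are
    closed under sums, products and composition ([Ck_add], [Ck_mul],
    [Ck_comp]). *)

(** * Calculus of C^k maps between normed modules *)

Section CkCalculus.
Context {R : realType} {V W : normedModType R}.
Implicit Types (U : set V) (f g : V -> W).

(** [Ck k U f] constrains the iterated derivatives of [f] at the points of [U]
    separately, which makes smoothness local. *)
Lemma Ck_local k U f :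
  (forall x, U x -> exists2 U' : set V, U' x & Ck k U' f) -> Ck k U f.
Proof.
elim: k f => [|k IH] f /= h; first by move=> x /h[U' U'x]; exact.
split=> [x /h[U' U'x [h1 _]]|v]; first exact: h1.
by apply: IH => x /h[U' U'x [_ h2]]; exists U'.
Qed.

Lemma near_eq_differentiable f g (x : V) :
  {near x, f =1 g} -> differentiable f x -> differentiable g x.
Proof.
move=> fg df; have fgx := nbhs_singleton fg.
have dg : g \o shift x = cst (g x) + 'd f x +o_ 0 id.
  apply/eqaddoP => e e0.
  have /eqaddoP/(_ _ e0) := diff_locally df.
  have : \forall h \near (0 : V), f (h + x) = g (h + x).
    by move: fg; rewrite (near_shift 0 x) subr0.
  apply: filterS2 => h /= fgh; rewrite -fgx.
  by rewrite -[(g \o _ - _) h]/(g (h + x) - _) -fgh.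
have dgf : 'd g x = 'd f x :> (V -> W).
  by apply: diff_unique dg; exact: diff_continuous.
by apply/diff_locallyP; rewrite dgf; split=> //; exact: diff_continuous.
Qed.

Lemma Ck_eq k U f g : open U -> {in U, f =1 g} -> Ck k U f -> Ck k U g.
Proof.
move=> oU; elim: k f g => [|k IH] f g fg /=.
  move=> h x Ux; have := h x Ux.
  rewrite /prop_for /continuous_at -(fg x) ?inE//.
  apply: cvg_trans; apply: near_eq_cvg.
  by apply: filterS (open_nbhs_nbhs (conj oU Ux)) => y Uy; rewrite fg ?inE.
have nfg x : U x -> {near x, f =1 g}.
  move=> Ux; apply: filterS (open_nbhs_nbhs (conj oU Ux)) => y Uy.
  by rewrite fg ?inE.
move=> [h1 h2]; split=> [x Ux|v].
  exact: near_eq_differentiable (nfg _ Ux) (h1 _ Ux).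
apply: IH (h2 v) => x; rewrite inE => Ux.
exact/near_eq_derive/nfg.
Qed.

Lemma CkW k U f : Ck k.+1 U f -> Ck k U f.
Proof.
elim: k f => [|k IH] f [h1 h2].
  by move=> x Ux; exact/differentiable_continuous/h1.
by split=> // v; exact: IH.
Qed.

Lemma Ck_cst k U (a : W) : Ck k U (cst a).
Proof.
elim: k a => [|k IH] a /=; first by move=> x _; exact: cvg_cst.
split=> [x _|v]; first exact: differentiable_cst.
rewrite (_ : 'D_v _ = cst 0) //; apply/funext => x; exact: derive_cst.
Qed.

Lemma Ck_add k U f g : open U -> Ck k U f -> Ck k U g -> Ck k U (f + g).
Proof.
move=> oU; elim: k f g => [|k IH] f g /=.
  by move=> hf hg x Ux; apply: continuousD; [exact: hf|exact: hg].
move=> [f1 f2] [g1 g2]; split=> [x Ux|v].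
  by apply: differentiableD; [exact: f1|exact: g1].
apply: Ck_eq (IH _ _ (f2 v) (g2 v)) => // x; rewrite inE => Ux /=.
by rewrite deriveD //; apply: diff_derivable; [exact: f1|exact: g1].
Qed.

Lemma Ck_sum k U I (r : seq I) (f : I -> V -> W) :
  open U -> (forall i, Ck k U (f i)) -> Ck k U (\sum_(i <- r) f i).
Proof.
move=> oU hf; elim/big_ind : _ => [|g h|i _] //; last exact: Ck_add.
exact: (@Ck_cst _ _ 0).
Qed.

Lemma Ck_linear k U f : linear f -> continuous f -> Ck k U f.
Proof.
move=> lf cf.
pose fM := GRing.isLinear.Build _ _ _ _ _ lf.
pose fL : {linear _ -> _} := HB.pack f fM.
case: k => [|k] /=; first by move=> x _; exact: cf.
split=> [x _|v]; first exact: (@linear_differentiable _ _ _ fL).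
rewrite (_ : 'D_v _ = cst (f v)); first exact: Ck_cst.
apply/funext => x; rewrite deriveE.
  by rewrite (@diff_lin _ _ _ fL).
exact: (@linear_differentiable _ _ _ fL).
Qed.

End CkCalculus.

Section CkScalar.
Context {R : realType} {V : normedModType R}.
Implicit Types (U : set V) (f g : V -> R).

Lemma Ck_mul k U f g : open U -> Ck k U f -> Ck k U g -> Ck k U (f * g).
Proof.
move=> oU; elim: k f g => [|k IH] f g /=.
  by move=> hf hg x Ux; apply: continuousM; [exact: hf|exact: hg].
move=> hf hg; have := CkW hf; have := CkW hg; move: hf hg.
move=> [f1 f2] [g1 g2] g0 f0; split=> [x Ux|v].
  by apply: differentiableM; [exact: f1|exact: g1].
have h := Ck_add oU (IH _ _ f0 (g2 v)) (IH _ _ g0 (f2 v)).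
apply: Ck_eq h => // x; rewrite inE => Ux.
by rewrite deriveM //; apply: diff_derivable; [exact: f1|exact: g1].
Qed.

Lemma Ck_scalel (W : normedModType R) k U f (w : W) :
  open U -> Ck k U f -> Ck k U (fun x => f x *: w).
Proof.
move=> oU; elim: k f => [|k IH] f /=.
  move=> hf x Ux; apply: continuousZr_tmp; exact: hf.
move=> [f1 f2]; split=> [x Ux|v].
  exact/differentiableZl/f1.
apply: Ck_eq (IH _ (f2 v)) => // x; rewrite inE => Ux.
rewrite [RHS]deriveE; last exact/differentiableZl/f1.
by rewrite diffZl ?deriveE //; exact: f1.
Qed.

End CkScalar.

Section CkCoordinates.
Context {R : realType} {V : normedModType R} {n : nat}.
Implicit Types (U : set V) (f : V -> 'rV[R]_n).

Lemma Ck_coord k (U : set 'rV[R]_n) j :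
  Ck k U (fun p : 'rV[R]_n => p 0 j).
Proof.
apply: Ck_linear => [a u v|]; first by rewrite !mxE.
exact: coord_continuous.
Qed.

Lemma Ck_of_coord k U f : open U ->
  (forall j, Ck k U (fun x => f x 0 j)) -> Ck k U f.
Proof.
move=> oU h.
rewrite (_ : f = \sum_(j < n) (fun x => f x 0 j *: delta_mx 0 j)).
  by apply: Ck_sum => // j; exact: Ck_scalel.
apply/funext => x; rewrite fct_sumE; exact: row_sum_delta.
Qed.

Lemma Ck_to_coord k U f j : open U -> Ck k U f -> Ck k U (fun x => f x 0 j).
Proof.
move=> oU; elim: k f => [|k IH] f /=.
  move=> hf x Ux.
  by apply: (@continuous_comp _ _ _ f (fun p : 'rV_n => p 0 j));
     [exact: hf|exact: coord_continuous].
move=> [f1 f2]; split=> [x Ux|v].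
  apply: (@differentiable_comp _ _ _ _ f (fun p : 'rV_n => p 0 j)).
    exact: f1.
  exact: differentiable_coord.
apply: Ck_eq (IH _ (f2 v)) => // x; rewrite inE => Ux.
by rewrite derive_mx ?mxE //; exact/diff_derivable/f1.
Qed.

(** The chain rule expresses a derivative of [g \o f] as
    [\sum_j D_v f_j * (D_j g \o f)], so that induction on [k] applies. *)
Lemma Ck_comp k U (O : set 'rV[R]_n) f (g : 'rV[R]_n -> R) :
  open U -> (forall x, U x -> O (f x)) -> Ck k U f -> Ck k O g ->
  Ck k U (g \o f).
Proof.
move=> oU fO; elim: k g => [|k IH] g.
  by move=> hf hg x Ux; apply: continuous_comp; [exact: hf|exact/hg/fO].
move=> hf; have := CkW hf; move: hf.
move=> [f1 f2] f0 [g1 g2]; split=> [x Ux|v].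
  by apply: differentiable_comp; [exact: f1|exact/g1/fO].
have h : Ck k U (\sum_(j < n) ((fun x => 'D_v f x 0 j) *
    ('D_(delta_mx 0 j) g \o f))).
  apply: Ck_sum => // j; apply: Ck_mul => //; last exact: IH _ f0 (g2 _).
  exact: Ck_to_coord (f2 v).
apply: Ck_eq h => // x; rewrite inE => Ux.
have dg := g1 _ (fO _ Ux); have df := f1 _ Ux.
rewrite [RHS]deriveE; last exact: differentiable_comp.
rewrite diff_comp //= -[X in 'd g _ X](deriveE v df).
rewrite [X in 'd g _ X]row_sum_delta linear_sum fct_sumE.
by apply: eq_bigr => j _; rewrite linearZ /= -(deriveE _ dg).
Qed.

End CkCoordinates.

Lemma Ck_comp_real (R : realType) (V : normedModType R) k (U : set V)
    (f : V -> R) (g : R -> R) :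
  open U -> Ck k U f -> Ck k setT g -> Ck k U (g \o f).
Proof.
move=> oU; elim: k g => [|k IH] g.
  by move=> hf hg x Ux; apply: continuous_comp; [exact: hf|exact: hg].
move=> hf; have := CkW hf; move: hf.
move=> [f1 f2] f0 [g1 g2]; split=> [x Ux|v].
  by apply: differentiable_comp; [exact: f1|exact: g1].
have h := Ck_mul oU (f2 v) (IH _ f0 (g2 1)).
apply: Ck_eq h => // x; rewrite inE => Ux.
have dg := g1 (f x) I; have df := f1 _ Ux.
rewrite [RHS]deriveE; last exact: differentiable_comp.
rewrite diff_comp //= -[X in 'd g _ X](deriveE v df).
by rewrite -[X in 'd g _ X]mulr1 [RHS]linearZ /= -(deriveE _ dg).
Qed.

(** * Smooth functions and smooth maps on manifolds *)

Lemma continuous_coordP (R : realType) (X : topologicalType) n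
    (f : X -> 'rV[R]_n) x :
  (forall j, {for x, continuous (fun y => f y 0 j)}) ->
  {for x, continuous f}.
Proof.
move=> h A [P nP PA].
have : \forall y \near x, forall j, P 0 j (f y 0 j).
  by apply: filter_forall => j; exact: (h j _ (nP 0 j)).
by apply: filterS => y Py; apply: PA => i j; rewrite ord1.
Qed.

Section ComplexParts.
Context {R : realType}.
Implicit Types z w : R[i].

Lemma ReD z w : complex.Re (z + w) = complex.Re z + complex.Re w.
Proof. by case: z; case: w. Qed.

Lemma ImD z w : complex.Im (z + w) = complex.Im z + complex.Im w.
Proof. by case: z; case: w. Qed.

Lemma ReM z w : complex.Re (z * w) =
  complex.Re z * complex.Re w - complex.Im z * complex.Im w.
Proof. by case: z; case: w. Qed.

Lemma ImM z w : complex.Im (z * w) =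
  complex.Re z * complex.Im w + complex.Im z * complex.Re w.
Proof. by case: z => a b; case: w => c e /=. Qed.

Lemma Re_conj z : complex.Re (z^*)%C = complex.Re z.
Proof. by case: z. Qed.

Lemma Im_conj z : complex.Im (z^*)%C = - complex.Im z.
Proof. by case: z. Qed.

End ComplexParts.

Section Charts.
Context {R : realType} {X : topologicalType} {m : nat}.
Implicit Types c : chart R X m.

Lemma chart_image_open c (U : set X) :
  is_chart c -> open U -> U `<=` cdom c -> open (cfun c @` U).
Proof.
move=> [oD oI cK cC iC] oU sU.
rewrite openE => _ [x Ux <-].
have Ix : (cfun c @` cdom c) (cfun c x) by exists x => //; exact: sU.
have n1 := open_nbhs_nbhs (conj oI Ix).
have : nbhs (cfun c x) (cinv c @^-1` U).
  by apply: (iC _ Ix); rewrite cK; [exact: open_nbhs_nbhs|exact: sU].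
move: n1; apply: filterS2 => p [y Dy <-] /=; rewrite cK // => Uy.
by exists y.
Qed.

Lemma chart_restr_open (Y : topologicalType) c (f : X -> Y) (V : set Y) :
  is_chart c -> continuous f -> open V ->
  open (cfun c @` (cdom c `&` f @^-1` V)).
Proof.
move=> hc cf oV; apply: chart_image_open => //.
apply: openI; first by case: hc.
by move/continuousP : cf; exact.
Qed.

End Charts.

Section SmoothFun.
Context {R : realType} {X : topologicalType} {m : nat}.
Variable A : set (chart R X m).
Hypothesis hA : smooth_atlas A.
Implicit Types f g : X -> R[i].

Let open_img c : A c -> open (cfun c @` cdom c).
Proof. by move=> Ac; have [/(_ _ Ac)[]] := hA. Qed.

Lemma smooth_cst (a : R[i]) : smooth_fun A (fun=> a).
Proof. by move=> c Ac; split=> k; exact: Ck_cst. Qed.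

Lemma smooth_add f g : smooth_fun A f -> smooth_fun A g ->
  smooth_fun A (fun x => f x + g x).
Proof.
move=> hf hg c Ac; have [f1 f2] := hf c Ac; have [g1 g2] := hg c Ac.
split=> k.
- have := Ck_add (open_img Ac) (f1 k) (g1 k).
  by congr Ck; apply/funext => p; rewrite ReD.
- have := Ck_add (open_img Ac) (f2 k) (g2 k).
  by congr Ck; apply/funext => p; rewrite ImD.
Qed.

Lemma smooth_mul f g : smooth_fun A f -> smooth_fun A g ->
  smooth_fun A (fun x => f x * g x).
Proof.
move=> hf hg c Ac; have [f1 f2] := hf c Ac; have [g1 g2] := hg c Ac.
have oI := open_img Ac.
split=> k.
- have := Ck_add oI (Ck_mul oI (f1 k) (g1 k))
    (Ck_mul oI (Ck_cst _ _ (-1 : R)) (Ck_mul oI (f2 k) (g2 k))).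
  by congr Ck; apply/funext => p; rewrite ReM -[in RHS]mulN1r.
- have := Ck_add oI (Ck_mul oI (f1 k) (g2 k)) (Ck_mul oI (f2 k) (g1 k)).
  by congr Ck; apply/funext => p; rewrite ImM.
Qed.

Lemma smooth_conj f : smooth_fun A f -> smooth_fun A (fun x => (f x)^*%C).
Proof.
move=> hf c Ac; have [f1 f2] := hf c Ac; have oI := open_img Ac.
split=> k.
- by have := f1 k; congr Ck; apply/funext => p; rewrite Re_conj.
- have := Ck_mul oI (Ck_cst _ _ (-1 : R)) (f2 k).
  by congr Ck; apply/funext => p; rewrite Im_conj -[in RHS]mulN1r.
Qed.

Lemma smooth_sum (I : Type) (r : seq I) (s : I -> X -> R[i]) :
  (forall i, smooth_fun A (s i)) -> smooth_fun A (fun x => \sum_(i <- r) s i x).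
Proof.
move=> hs; elim: r => [|i r IH].
  rewrite (_ : (fun _ => _) = fun=> 0); first exact: smooth_cst.
  by apply/funext => x; rewrite big_nil.
have := smooth_add (hs i) IH.
by congr smooth_fun; apply/funext => x; rewrite big_cons.
Qed.

Lemma smooth_lin (a : R[i]) f g : smooth_fun A f -> smooth_fun A g ->
  smooth_fun A (fun x => a * f x + g x).
Proof.
move=> hf hg; apply: smooth_add => //.
by apply: smooth_mul => //; exact: smooth_cst.
Qed.

Lemma smooth_continuous f : smooth_fun A f ->
  continuous (fun x => complex.Re (f x) : R) /\
  continuous (fun x => complex.Im (f x) : R).
Proof.
move=> hf.
have key (u : X -> R) : (forall c, A c ->
    smooth_on (cfun c @` cdom c) (fun p => u (cinv c p))) -> continuous u.
  move=> hu x; have [hc hcov _] := hA.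
  have [c Ac Dx] := hcov x; have [oD oI cK cC iC] := hc _ Ac.
  have ic : (cfun c @` cdom c) (cfun c x) by exists x.
  have h := continuous_comp (cC _ Dx) (hu c Ac 0 _ ic).
  move: h; rewrite /prop_for /continuous_at /= cK //; apply: cvg_trans.
  apply: near_eq_cvg; apply: filterS (open_nbhs_nbhs (conj oD Dx)) => y Dy.
  by rewrite /= cK.
by split; apply: key => c Ac; have [] := hf c Ac.
Qed.

Lemma smooth_map_realify M (u : 'I_M -> X -> R[i]) :
  (forall j, smooth_fun A (u j)) ->
  smooth_map A (Cspace M) (fun x => realify (\row_j u j x)).
Proof.
move=> hu; split.
  move=> x; apply: continuous_coordP => j.
  case: (split_ordP j) => i ->.
  - rewrite (_ : (fun _ => _) = fun y => complex.Re (u i y)).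
      exact: (smooth_continuous (hu i)).1.
    by apply/funext => y; rewrite row_mxEl !mxE.
  - rewrite (_ : (fun _ => _) = fun y => complex.Im (u i y)).
      exact: (smooth_continuous (hu i)).2.
    by apply/funext => y; rewrite row_mxEr !mxE.
move=> c _ Ac -> k; have oI := open_img Ac; rewrite /= preimage_setT setIT.
apply: Ck_of_coord => // j; case: (split_ordP j) => i ->.
- have := (hu i _ Ac).1 k; congr Ck.
  by apply/funext => y; rewrite row_mxEl !mxE.
- have := (hu i _ Ac).2 k; congr Ck.
  by apply/funext => y; rewrite row_mxEr !mxE.
Qed.

End SmoothFun.

Lemma smooth_fun_comp (R : realType) (X Y : topologicalType) (m p : nat)
    (A : set (chart R X m)) (B : set (chart R Y p)) (f : X -> Y) u :
  smooth_atlas A -> smooth_atlas B -> smooth_map A B f -> smooth_fun B u ->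
  smooth_fun A (u \o f).
Proof.
move=> [hA covA _] [hB covB _] [cf sf] su c Ac; have hc := hA _ Ac.
have key (v : Y -> R) : (forall d, B d ->
    smooth_on (cfun d @` cdom d) (fun q => v (cinv d q))) ->
    smooth_on (cfun c @` cdom c) (fun q => v (f (cinv c q))).
  move=> hv k; apply: Ck_local => q -[x Dx <-{q}].
  have [d Bd Dfx] := covB (f x); have [oD oI dK dC iC] := hB _ Bd.
  have oU := chart_restr_open hc cf oD.
  exists (cfun c @` (cdom c `&` f @^-1` cdom d)); first by exists x.
  apply: Ck_eq (Ck_comp oU _ (sf c d Ac Bd k) (hv d Bd k)) => //.
    move=> _ /set_mem[y [Dy Dfy] <-] /=.
    by rewrite dK //; have [_ _ -> ] := hc.
  move=> _ [y [Dy Dfy] <-] /=; have [_ _ cK _ _] := hc.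
  by exists (f y) => //; rewrite cK.
split.
- by apply: (key (fun y => complex.Re (u y))) => d Bd; have [] := su d Bd.
- by apply: (key (fun y => complex.Im (u y))) => d Bd; have [] := su d Bd.
Qed.

Lemma Cspace_atlas (R : realType) M : smooth_atlas (@Cspace R M).
Proof.
split.
- move=> _ ->; split=> //=; [exact: openT|rewrite image_id; exact: openT| |].
    by move=> x _; exact: cvg_id.
  by move=> x _; exact: cvg_id.
- by move=> x; exists (Chart setT id id).
- move=> _ _ -> -> k; apply: Ck_linear; first by move=> a u v.
  by move=> x; exact: cvg_id.
Qed.

Section ProductCharts.
Context {R : realType} {X Y : topologicalType} {m p : nat}.

Lemma is_chart_prod (c : chart R X m) (d : chart R Y p) :
  is_chart c -> is_chart d -> is_chart (prod_chart c d).
Proof.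
move=> [oc oic cK cC ciC] [od oid dK dC diC]; split => /=.
- have -> : cdom c `*` cdom d = fst @^-1` cdom c `&` snd @^-1` cdom d by [].
  apply: openI.
  + by apply: open_comp => // -[x y] _; exact: cvg_fst.
  + by apply: open_comp => // -[x y] _; exact: cvg_snd.
- set I := (X in open X).
  have -> : I = (lsubmx @^-1` (cfun c @` cdom c) : set 'rV[R]_(m + p)) `&`
                (rsubmx @^-1` (cfun d @` cdom d)).
    apply/seteqP; split=> [_ [[x y] [/= Dx Dy] <-]|v [[x Dx hx] [y Dy hy]]] /=.
      by rewrite row_mxKl row_mxKr; split; [exists x|exists y].
    by exists (x, y) => //=; rewrite hx hy hsubmxK.
  apply: openI.
  + by apply: open_comp => // v _; exact: continuous_lsubmx.
  + by apply: open_comp => // v _; exact: continuous_rsubmx.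
- by move=> [x y] [/= Dx Dy]; rewrite row_mxKl row_mxKr cK // dK.
- move=> [x y] [/= Dx Dy]; apply: continuous_coordP => j.
  case: (split_ordP j) => i ->.
  + rewrite (_ : (fun _ => _) = ((fun v : 'rV[R]_m => v 0 i) \o cfun c) \o fst).
      apply: continuous_comp; first exact: cvg_fst.
      by apply: continuous_comp; [exact: cC|exact: coord_continuous].
    by apply/funext => z; rewrite row_mxEl.
  + rewrite (_ : (fun _ => _) = ((fun v : 'rV[R]_p => v 0 i) \o cfun d) \o snd).
      apply: continuous_comp; first exact: cvg_snd.
      by apply: continuous_comp; [exact: dC|exact: coord_continuous].
    by apply/funext => z; rewrite row_mxEr.
- move=> _ [[x y] [/= Dx Dy] <-]; set v := row_mx _ _.
  have h1 : {for v, continuous (cinv c \o lsubmx)}.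
    apply: continuous_comp; first exact: continuous_lsubmx.
    by rewrite row_mxKl; apply: ciC; exists x.
  have h2 : {for v, continuous (cinv d \o rsubmx)}.
    apply: continuous_comp; first exact: continuous_rsubmx.
    by rewrite row_mxKr; apply: diC; exists y.
  exact: cvg_pair h1 h2.
Qed.

(** In the chart [prod_chart b c] the inclusion of a slice is the affine map
    [q |-> row_mx (cfun b g) q]. *)
Lemma smooth_map_slice (Z : topologicalType) (r : nat) (B : set (chart R X m))
    (A : set (chart R Y p)) (C : set (chart R Z r)) (h : X * Y -> Z) g :
  smooth_atlas A -> smooth_atlas B -> smooth_atlas C ->
  smooth_map (prod_atlas B A) C h ->
  smooth_map A C (fun x => h (g, x)).
Proof.
move=> [hA covA _] [hB covB _] [hC covC _] [ch sh].
have cslice : continuous (fun x => h (g, x)).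
  move=> x; apply: (@continuous_comp _ _ _ (fun x => (g, x)) h); last exact: ch.
  by apply: cvg_pair; [exact: cvg_cst|exact: cvg_id].
split=> // c d Ac Cd k; have hc := hA _ Ac.
have [b Bb Dg] := covB g; have hb := hB _ Bb.
have [oD _ _ _ _] := hC _ Cd.
have oU := chart_restr_open hc cslice oD.
apply: Ck_of_coord => // j.
set O := cfun (prod_chart b c) @` (cdom (prod_chart b c) `&` h @^-1` cdom d).
have oO : open O by apply: chart_restr_open => //; exact: is_chart_prod.
have Pbc : prod_atlas B A (prod_chart b c) by exists b => //; exists c.
have hO := Ck_to_coord j oO (sh _ _ Pbc Cd k).
set U := cfun c @` _.
have hf : Ck k U (fun q => row_mx (cfun b g) q).
  apply: Ck_of_coord => // i; case: (split_ordP i) => l ->.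
  + rewrite (_ : (fun _ => _) = cst (cfun b g 0 l)); first exact: Ck_cst.
    by apply/funext => q; rewrite row_mxEl.
  + rewrite (_ : (fun _ => _) = fun q : 'rV[R]_p => q 0 l).
      exact: Ck_coord.
    by apply/funext => q; rewrite row_mxEr.
apply: Ck_eq (Ck_comp oU _ hf hO) => //.
  move=> q _ /=; rewrite row_mxKl row_mxKr.
  by have [_ _ -> ] := hb.
by move=> _ [x [Dx hx] <-]; exists (g, x).
Qed.

End ProductCharts.

(** * Smooth cutoff functions *)

Section FlatFunctions.
Context {R : realType}.
Implicit Types p q : {poly R}.

(** The functions [t |-> p(1/t) exp(-1/t)], continued by 0 to [t <= 0], form a
    class that is closed under differentiation; this is why [flat 1] is
    smooth. *)
Definition flat p (t : R) : R :=
  if 0 < t then p.[t^-1] * expR (- t^-1) else 0.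

(** The exponential series gives [s ^ (i+1) / (i+1)! <= exp s] for [s = 1/t]. *)
Lemma flat_monomial_le (i : nat) (t : R) :
  0 < t -> t^-1 ^+ i * expR (- t^-1) <= i.+1`!%:R * t.
Proof.
move=> t0; have s0 : 0 < t^-1 by rewrite invr_gt0.
have h : t^-1 ^+ i.+1 / i.+1`!%:R <= expR t^-1.
  apply: le_trans (expR_ge1Dxn i (ltW s0)); by rewrite lerDr.
have f0 : 0 < (i.+1`!%:R : R) by rewrite ltr0n fact_gt0.
rewrite expRN ler_pdivrMr ?expR_gt0 //.
apply: le_trans (_ : i.+1`!%:R * t * (t^-1 ^+ i.+1 / i.+1`!%:R) <= _); last first.
  by rewrite ler_pM2l // mulr_gt0.
rewrite exprS le_eqVlt; apply/orP; left; apply/eqP.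
by field; rewrite !gt_eqF.
Qed.

Lemma flat_le p : exists C, forall t, `|flat p t| <= C * `|t|.
Proof.
exists (\sum_(i < size p) `|p`_i| * i.+1`!%:R) => t; rewrite /flat.
case: ifPn => [t0|_]; last first.
  by rewrite normr0 mulr_ge0 // sumr_ge0 // => i _; rewrite mulr_ge0.
rewrite horner_coef mulr_suml (gtr0_norm t0) mulr_suml.
apply: le_trans (ler_norm_sum _ _ _) _; apply: ler_sum => i _.
rewrite -mulrA normrM -mulrA; apply: ler_wpM2l => //.
rewrite ger0_norm; first exact: flat_monomial_le.
by rewrite mulr_ge0 ?expR_ge0 // exprn_ge0 // invr_ge0 ltW.
Qed.

Lemma flat_derive p t :
  is_derive t (1 : R) (flat p) (flat ('X^2 * (p - p^`())) t).
Proof.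
have [t0|t0|->] := ltgtP t 0.
- rewrite /flat [in X in is_derive _ _ _ X]ltNge (ltW t0) /=.
  apply: (@near_eq_is_derive _ _ _ (cst 0)).
  near=> s.
  have s0 : s < 0 by near: s; exact: lt_nbhsl.
  by rewrite (lt_gtF s0).
- rewrite /flat [in X in is_derive _ _ _ X]t0 /=.
  set D := (X in is_derive _ _ _ X).
  apply: (@near_eq_is_derive _ _ _
    ((fun s => p.[s] * expR (- s)) \o (fun t => t^-1))).
    near=> s; rewrite /flat /=.
    have -> // : 0 < s.
    by near: s; exact: lt_nbhsr.
  have dp : is_derive t^-1 1 (horner p) (p^`().[t^-1]).
    by rewrite derivE derive1E; apply: derivableP; exact: derivable_horner.
  have dinv : is_derive t 1 (fun t : R => t^-1) (- t^-2).
    have tn0 : (id : R -> R) t != 0 by rewrite gt_eqF.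
    have := is_deriveV tn0 (is_derive_id t 1).
    by rewrite [_ *: _]mulr1.
  have dexp : is_derive t^-1 1 (fun s : R => expR (- s)) (expR (- t^-1) * (-1)).
    have dn : is_derive t^-1 (1 : R) (-%R) (-1).
      exact: (is_deriveN (is_derive_id _ _)).
    by have := is_derive1_comp (is_derive_expR _) dn.
  have dG := is_deriveM dp dexp.
  have dH := is_derive1_comp dG dinv.
  apply: (is_derive_eq dH).
  rewrite /D !hornerE /= -![_ *: _]/(_ * _).
  by rewrite -exprVn; ring.
(* The difference quotient of [flat p] at 0 is [flat ('X * p)]. *)
- rewrite [X in is_derive _ _ _ X]/flat ltxx.
  have [C hC] := flat_le ('X * p).
  have quot : h^-1 *: (flat p (h *: (1 : R) + 0) - flat p 0) @[h --> 0^'] --> 0.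
    apply/cvgr0Pnorm_le => e e0; near=> h.
    have h0 : h != 0 by near: h; exact: nbhs_dnbhs_neq.
    have -> : h^-1 *: (flat p (h *: (1 : R) + 0) - flat p 0) = flat ('X * p) h.
      rewrite addr0 [h *: 1]mulr1 /flat ltxx subr0.
      case: ifP => _; last by rewrite scaler0.
      by rewrite hornerM hornerX -mulrA.
    apply: le_trans (hC h) _.
    have C1 : 0 < `|C| + 1 by rewrite ltr_wpDl.
    apply: (@le_trans _ _ ((`|C| + 1) * `|h|)).
      by rewrite ler_wpM2r // (le_trans (ler_norm _)) // lerDl.
    rewrite mulrC -ler_pdivlMr // ltW //.
    by near: h; apply: dnbhs0_lt; rewrite divr_gt0.
  by apply: DeriveDef; [apply/cvg_ex; exists 0|exact: cvg_lim quot].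
Unshelve. all: by end_near. Qed.

Lemma Ck_flat k p : Ck k setT (flat p).
Proof.
have df q t : differentiable (flat q) t.
  by apply/derivable1_diffP; have [] := flat_derive q t.
elim: k p => [|k IH] p /=; first by move=> t _; exact: differentiable_continuous.
split=> // v.
rewrite (_ : 'D_v (flat p) = flat (v *: ('X^2 * (p - p^`())))); first exact: IH.
apply/funext => t; rewrite deriveE // -[v]mulr1 linearZ /= -deriveE //.
rewrite (@derive_val _ _ _ _ _ _ _ (flat_derive p t)) mulr1 /flat.
by case: ifP => _; rewrite ?scaler0 // hornerZ -mulrA.
Qed.

Lemma flat1_gt0 t : 0 < t -> 0 < flat 1 t.
Proof. by move=> t0; rewrite /flat t0 hornerC mul1r expR_gt0. Qed.

Lemma flat_le0 p t : t <= 0 -> flat p t = 0.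
Proof. by move=> t0; rewrite /flat ltNge t0. Qed.

End FlatFunctions.

Lemma Ck_prod (R : realType) (V : normedModType R) k (U : set V) (I : Type)
    (r : seq I) (f : I -> V -> R) :
  open U -> (forall i, Ck k U (f i)) -> Ck k U (fun x => \prod_(i <- r) f i x).
Proof.
move=> oU hf; elim: r => [|i r IH].
  rewrite (_ : (fun _ => _) = cst 1); first exact: Ck_cst.
  by apply/funext => x; rewrite big_nil.
have := Ck_mul oU (hf i) IH.
by congr Ck; apply/funext => x; rewrite big_cons.
Qed.

Section Bump.
Context {R : realType} {m : nat}.

Definition cube (a : 'rV[R]_m) (r : R) : set 'rV[R]_m :=
  [set p | forall j, p 0 j \in `[a 0 j - r, a 0 j + r]].

Definition cube_bump (a : 'rV[R]_m) (r : R) (p : 'rV[R]_m) : R :=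
  \prod_(j < m) (flat 1 (r - a 0 j + p 0 j) * flat 1 (r + a 0 j - p 0 j)).

Lemma cube_bump_center a r : 0 < r -> cube_bump a r a != 0.
Proof.
move=> r0; rewrite gt_eqF // prodr_gt0 // => j _.
by rewrite mulr_gt0 // flat1_gt0 //; lra.
Qed.

Lemma cube_bump_out a r p : ~ cube a r p -> cube_bump a r p = 0.
Proof.
move=> /existsNP[j hj]; rewrite /cube_bump (bigD1 j) //=.
suff -> : flat 1 (r - a 0 j + p 0 j) * flat 1 (r + a 0 j - p 0 j) = 0.
  by rewrite mul0r.
apply/eqP; rewrite mulf_eq0; apply/orP; apply: contra_notP hj.
rewrite in_itv /= => /not_orP[h1 h2].
apply/andP; split; rewrite leNgt; apply/negP => h.
- by apply: h1; rewrite flat_le0 //; lra.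
- by apply: h2; rewrite flat_le0 //; lra.
Qed.

Lemma Ck_cube_bump k a r U : open U -> Ck k U (cube_bump a r).
Proof.
move=> oU; apply: Ck_prod => // j.
have lin (b c : R) : Ck k U (fun p : 'rV[R]_m => b + c * p 0 j).
  apply: Ck_add => //; first exact: Ck_cst.
  by apply: Ck_mul => //; [exact: Ck_cst|exact: Ck_coord].
apply: Ck_mul => //.
- have := Ck_comp_real oU (lin (r - a 0 j) 1) (Ck_flat k 1).
  by congr Ck; apply/funext => p /=; rewrite mul1r.
- have := Ck_comp_real oU (lin (r + a 0 j) (-1)) (Ck_flat k 1).
  by congr Ck; apply/funext => p /=; rewrite mulN1r.
Qed.

Lemma cube_compact a r : compact (cube a r).
Proof.
apply: (@rV_compact R m (fun j => `[a 0 j - r, a 0 j + r]%classic)) => j.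
exact: segment_compact.
Qed.

Lemma nbhs_cube (a : 'rV[R]_m) (V : set 'rV[R]_m) :
  nbhs a V -> exists2 r : R, 0 < r & cube a r `<=` V.
Proof.
move=> /nbhs_ballP[e /= e0 eV]; exists (e / 2); first by rewrite divr_gt0.
move=> p hp; apply: eV; split=> // i j; rewrite ord1.
have := hp j; rewrite in_itv /= => /andP[h1 h2].
by rewrite -ball_normE /= ltr_norml; apply/andP; split; lra.
Qed.

End Bump.

(** A cutoff function in a chart, continued by 0, is smooth because its
    support is compact, hence closed in the Hausdorff space [X]. *)
Lemma smooth_bump (R : realType) (X : topologicalType) (m : nat)
    (A : set (chart R X m)) (U : set X) x :
  smooth_manifold A -> open U -> U x ->
  exists rho : X -> R[i],
    [/\ smooth_fun A rho, rho x != 0 & forall y, ~ U y -> rho y = 0].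
Proof.
move=> [hX _ [hA covA tA]] oU Ux.
have [c Ac Dx] := covA x; have hc := hA _ Ac.
have [oD oI cK cC iC] := hc.
have oV : open (cfun c @` (cdom c `&` U)).
  by apply: chart_image_open => //; exact: openI.
have [|r r0 rV] := @nbhs_cube _ _ (cfun c x) (cfun c @` (cdom c `&` U)).
  by apply: open_nbhs_nbhs; split=> //; exists x.
set a := cfun c x in rV *.
pose K := cinv c @` cube a r.
have KU y : K y -> cdom c y /\ U y.
  by move=> [p /rV[z [Dz Uz] <-] <-]; rewrite cK.
have clK : closed K.
  apply: compact_closed => //.
  apply: continuous_compact; last exact: cube_compact.
  apply: continuous_in_subspaceT => p /set_mem /rV[z [Dz Uz] pz].
  by apply: iC; exists z.
pose rho y : R := if `[< cdom c y >] then cube_bump a r (cfun c y) else 0.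
have rho0 y : ~ K y -> rho y = 0.
  move=> Ky; rewrite /rho; case: asboolP => // Dy; apply: cube_bump_out => hy.
  by apply: Ky; exists (cfun c y) => //; rewrite cK.
exists (fun y => (rho y)%:C%C); split.
- move=> d Ad; have [oDd oId dK dC diC] := hA _ Ad.
  split=> k /=; last exact: Ck_cst.
  apply: Ck_local => _ [y Dy <-].
  have [Dcy|Dcy] := pselect (cdom c y).
    exists (overlap d c); first by exists y.
    have oO : open (overlap d c).
      by apply: chart_image_open; [exact: hA|exact: openI|].
    have oT : open (setT : set 'rV[R]_m) := openT.
    have h := Ck_comp oO (fun _ _ => I) (tA _ _ Ad Ac k) (Ck_cube_bump k a r oT).
    apply: Ck_eq h => // _ /set_mem[z [Ddz Dcz] <-] /=.
    by rewrite /rho /transition /= dK // asboolT.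
  exists (cfun d @` (cdom d `&` ~` K)).
    by exists y => //; split=> // /KU[].
  have oO : open (cfun d @` (cdom d `&` ~` K)).
    apply: chart_image_open; [exact: hA| |by move=> z []].
    by apply: openI => //; exact: closed_openC.
  apply: Ck_eq (@Ck_cst _ _ _ k _ (0 : R)) => // _ /set_mem[z [Dz Kz] <-] /=.
  by rewrite dK // rho0.
- rewrite /rho asboolT //; apply: contraNneq (cube_bump_center a r0).
  by move=> /(congr1 (@complex.Re R)) /= ->.
- by move=> y Uy; rewrite rho0 // => /KU[].
Qed.

(** * Finite-dimensional spaces of functions and their duals *)

Section Spans.
Context {R : realType} {T : Type}.
Implicit Types (S : set (T -> R[i])) (h w : T -> R[i]).

Definition subspace S : Prop :=
  S 0 /\ forall a h k, S h -> S k -> S (fun t => a * h t + k t).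

Lemma subspace_sum S (I : Type) (r : seq I) (c : I -> R[i])
    (s : I -> T -> R[i]) :
  subspace S -> (forall i, S (s i)) -> S (fun t => \sum_(i <- r) c i * s i t).
Proof.
move=> [S0 Slin] hs; elim: r => [|i r IH].
  rewrite (_ : (fun _ => _) = 0) //.
  by apply/funext => t; rewrite big_nil.
rewrite (_ : (fun _ => _) = fun t => c i * s i t + \sum_(j <- r) c j * s j t).
  exact: Slin.
by apply/funext => t; rewrite big_cons.
Qed.

Lemma subspace_lcomb S k (c : 'I_k -> R[i]) (s : 'I_k -> T -> R[i]) :
  subspace S -> (forall i, S (s i)) -> S (lcomb c s).
Proof. exact: subspace_sum. Qed.

Lemma sub_cspan S : S `<=` cspan S.
Proof.
move=> h Sh; exists 1%N, (fun=> 1), (fun=> h); split=> //.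
by apply/funext => t; rewrite /lcomb big_ord1 mul1r.
Qed.

Lemma cspan_min S S' : subspace S' -> S `<=` S' -> cspan S `<=` S'.
Proof.
by move=> hS' sS _ [k [c [s [Ss ->]]]]; apply: subspace_lcomb => // i; exact: sS.
Qed.

Lemma subspace_cspan S : subspace (cspan S).
Proof.
split.
  exists 0%N, (fun=> 0), (fun=> 0); split; first by case.
  by apply/funext => t; rewrite /lcomb big_ord0.
move=> a _ _ [k [c [s [Ss ->]]]] [k' [c' [s' [Ss' ->]]]].
exists (k + k')%N, (fun i => match fintype.split i with
    inl j => a * c j | inr j => c' j end),
  (fun i => match fintype.split i with inl j => s j | inr j => s' j end).
split; first by move=> i; case: fintype.split.
apply/funext => t; rewrite /lcomb big_split_ord mulr_sumr /=; congr (_ + _).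
  by apply: eq_bigr => i _; rewrite (unsplitK (inl i)) mulrA.
by apply: eq_bigr => i _; rewrite (unsplitK (inr i)).
Qed.

Lemma subspace_lcombs k (s : 'I_k -> T -> R[i]) :
  subspace [set lcomb c s | c in setT].
Proof.
split.
  exists (fun=> 0) => //; apply/funext => t.
  by rewrite /lcomb big1 // => i _; rewrite mul0r.
move=> a _ _ [c _ <-] [c' _ <-]; exists (fun i => a * c i + c' i) => //.
apply/funext => t; rewrite /lcomb mulr_sumr -big_split /=.
by apply: eq_bigr => i _; rewrite mulrDl mulrA.
Qed.

Lemma lcomb_delta k (s : 'I_k -> T -> R[i]) i :
  lcomb (fun j => (j == i)%:R) s = s i.
Proof.
apply/funext => t; rewrite /lcomb (bigD1 i) //= eqxx mul1r big1 ?addr0 //.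
by move=> j /negbTE ->; rewrite mul0r.
Qed.

Lemma cspan_range k (s : 'I_k -> T -> R[i]) :
  cspan (range s) = [set lcomb c s | c in setT].
Proof.
apply/seteqP; split.
  apply: cspan_min; first exact: subspace_lcombs.
  by move=> _ [i _ <-]; exists (fun j => (j == i)%:R) => //; exact: lcomb_delta.
by move=> _ [c _ <-]; exists k, c, s; split=> // i; exists i.
Qed.

Definition independent k (s : 'I_k -> T -> R[i]) : Prop :=
  forall c, lcomb c s = 0 -> forall i, c i = 0.

(** If [K < l], the [l x K] matrix of the coefficients of [s] in terms of [e]
    has a nonzero row in its kernel, which is a linear relation. *)
Lemma independent_le K (e : 'I_K -> T -> R[i]) l (s : 'I_l -> T -> R[i]) :
  (forall i, cspan (range e) (s i)) -> independent s -> (l <= K)%N.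
Proof.
move=> hs free_s; rewrite leqNgt; apply/negP => Kl.
have /choice[B hB] : forall i, exists c, lcomb c e = s i.
  by move=> i; have := hs i; rewrite cspan_range => -[c _ <-]; exists c.
pose MB : 'M[R[i]]_(l, K) := \matrix_(i, j) B i j.
have /rowV0Pn[v /sub_kermxP vB v0] : kermx MB != 0.
  rewrite kermx_eq0 /row_free neq_ltn; apply/orP; left.
  by apply: leq_ltn_trans Kl; exact: rank_leq_col.
have vs : lcomb (fun i => v 0 i) s = 0.
  apply/funext => t; rewrite /lcomb.
  under eq_bigr => i _ do rewrite -hB /lcomb mulr_sumr.
  rewrite exchange_big big1 //= => j _.
  have := congr1 (fun M : 'rV_K => M 0 j) vB; rewrite !mxE => vBj.
  under eq_bigr => i _ do rewrite mulrA.
  rewrite -mulr_suml [X in X * _](_ : _ = 0) ?mul0r // -[RHS]vBj.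
  by apply: eq_bigr => i _; rewrite mxE.
by case/eqP: v0; apply/rowP => i; rewrite mxE; exact: free_s vs i.
Qed.

(** A maximal independent family of a subspace is a basis; lengths are bounded
    since the subspace lies in the span of finitely many functions. *)
Lemma has_dim_sub K (e : 'I_K -> T -> R[i]) S :
  subspace S -> S `<=` cspan (range e) -> exists M, has_dim S M.
Proof.
move=> subS Se.
pose P l := `[< exists s : 'I_l -> T -> R[i],
                  (forall i, S (s i)) /\ independent s >].
have P0 : exists l, P l.
  by exists 0%N; apply/asboolP; exists (fun=> 0); split=> [[]|c _ []].
have Ple l : P l -> (l <= K)%N.
  move=> /asboolP[s [Ss free_s]]; apply: independent_le free_s => i; exact/Se.
case: (ex_maxnP P0 Ple) => l /asboolP[s [Ss free_s]] lmax.
exists l, s; split=> //; apply/seteqP; split.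
  by apply: cspan_min => // _ [i _ <-].
move=> w Sw; rewrite cspan_range.
pose s' (i : 'I_l.+1) := if unlift ord_max i is Some j then s j else w.
have Ss' i : S (s' i) by rewrite /s'; case: unliftP.
have : ~ independent s'.
  move=> free'; suff : (l.+1 <= l)%N by rewrite ltnn.
  by apply: lmax; apply/asboolP; exists s'.
move=> /existsNP[c /not_implyP[c0 /existsNP[i ci]]].
have e1 t : \sum_(j < l) c (lift ord_max j) * s j t + c ord_max * w t = 0.
  rewrite -[RHS]/((0 : T -> R[i]) t) -c0 /lcomb big_ord_recr /=.
  congr (_ + _); last by rewrite /s' unlift_none.
  apply: eq_bigr => j _.
  have -> : widen_ord (leqnSn l) j = lift ord_max j.
    by apply/val_inj; rewrite /= /bump leqNgt ltn_ord.
  by rewrite /s' liftK.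
have cw : c ord_max != 0.
  apply: contra_notN ci => /eqP cm0.
  have cl0 : lcomb (fun j => c (lift ord_max j)) s = 0.
    by apply/funext => t; have := e1 t; rewrite cm0 mul0r addr0.
  by case: (unliftP ord_max i) => [j ->|->] //; exact: free_s cl0 j.
exists (fun j => - (c ord_max)^-1 * c (lift ord_max j)) => //.
apply/funext => t; rewrite /lcomb.
under eq_bigr => j _ do rewrite -mulrA.
rewrite -mulr_sumr; move/eqP: (e1 t); rewrite addr_eq0 => /eqP ->.
by rewrite mulrNN mulKf.
Qed.

End Spans.

Section Dual.
Context {R : realType} {T : Type} {W : set (T -> R[i])} {M : nat}.
Hypothesis subW : subspace W.
Implicit Types l : (T -> R[i]) -> R[i].

Lemma subspace_dual : subspace (dual W).
Proof.
split; first by split=> // a h k _ _; rewrite mulr0 addr0.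
move=> a l k [l1 l2] [k1 k2]; split=> [b h g Wh Wg|h Wh].
  by rewrite l1 // k1 //; ring.
by rewrite l2 // k2 // mulr0 addr0.
Qed.

Lemma dual_lcomb l k (c : 'I_k -> R[i]) (s : 'I_k -> T -> R[i]) :
  dual W l -> (forall i, W (s i)) -> l (lcomb c s) = \sum_i c i * l (s i).
Proof.
move=> [l1 _] Ws; have [W0 Wlin] := subW.
have l0 : l 0 = 0.
  have := l1 1 0 0 W0 W0.
  rewrite (_ : (fun _ => _) = 0); last first.
    by apply/funext => t /=; rewrite mulr0 addr0.
  by rewrite mul1r => /eqP; rewrite -subr_eq subrr => /eqP <-.
rewrite /lcomb.
suff H (r : seq 'I_k) : W (fun t => \sum_(i <- r) c i * s i t) /\
    l (fun t => \sum_(i <- r) c i * s i t) = \sum_(i <- r) c i * l (s i).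
  exact: (H (index_enum _)).2.
elim: r => [|i r [IH1 IH2]].
  rewrite (_ : (fun _ => _) = 0) ?big_nil //.
  by apply/funext => t; rewrite big_nil.
rewrite (_ : (fun _ => _) = fun t => c i * s i t + \sum_(j <- r) c j * s j t).
  by split; [exact: Wlin|rewrite l1 // IH2 big_cons].
by apply/funext => t; rewrite big_cons.
Qed.

Variable s : 'I_M -> T -> R[i].
Hypothesis sW : is_basis W s.

Let Ws i : W (s i).
Proof. by case: sW => _ <-; apply: sub_cspan; exists i. Qed.

Let coordinates h : W h -> exists c, h = lcomb c s.
Proof. by case: sW => _ <-; rewrite cspan_range => -[c _ <-]; exists c. Qed.

Lemma dual_ext l k : dual W l -> dual W k ->
  (forall i, l (s i) = k (s i)) -> l = k.
Proof.
move=> dl dk lk; apply/funext => h.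
have [/coordinates[c ->]|Wh] := pselect (W h).
  by rewrite !dual_lcomb //; apply: eq_bigr => i _; rewrite lk.
by rewrite (dl.2 _ Wh) (dk.2 _ Wh).
Qed.

Lemma dual_exists (z : 'I_M -> R[i]) :
  exists2 l, dual W l & forall i, l (s i) = z i.
Proof.
have free_s := sW.1; have [W0 Wlin] := subW.
have /choice[co hco] : forall h, exists c, W h -> h = lcomb c s.
  move=> h; have [/coordinates[c hc]|Wh] := pselect (W h); first by exists c.
  by exists (fun=> 0).
have uniq_co h c : W h -> h = lcomb c s -> co h = c.
  move=> Wh hc; apply/funext => i; apply/eqP; rewrite -subr_eq0; apply/eqP.
  apply: (free_s (fun i => co h i - c i)); apply/funext => t.
  have : lcomb (co h) s t - lcomb c s t = 0 by rewrite -hc -(hco h Wh) subrr.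
  rewrite /lcomb -sumrB => hh; rewrite -[RHS]hh.
  by apply: eq_bigr => j _; rewrite mulrBl.
exists (fun h => if `[< W h >] then \sum_i co h i * z i else 0).
  split=> [a h k Wh Wk|h Wh]; last by rewrite asboolF.
  rewrite !asboolT //; last exact: Wlin.
  rewrite (uniq_co _ (fun i => a * co h i + co k i)); [|exact: Wlin|].
    rewrite mulr_sumr -big_split; apply: eq_bigr => i _.
    by rewrite mulrDl mulrA.
  apply/funext => t; rewrite {1}(hco h Wh) {1}(hco k Wk) /lcomb mulr_sumr.
  by rewrite -big_split; apply: eq_bigr => i _; rewrite mulrDl mulrA.
move=> i; rewrite asboolT //.
rewrite (uniq_co _ (fun j => (j == i)%:R)) ?lcomb_delta //.
rewrite (bigD1 i) //= eqxx mul1r big1 ?addr0 // => j /negbTE ->.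
by rewrite mul0r.
Qed.

Lemma linear_iso_basis : linear_iso (dual W) (fun l => \row_j l (s j)).
Proof.
split=> [a l k dl dk|l k dl dk /rowP lk|z].
- by apply/rowP => j; rewrite !mxE.
- by apply: dual_ext => // i; have := lk i; rewrite !mxE.
- have [l dl lz] := dual_exists (fun j => z 0 j).
  by exists l => //; apply/rowP => j; rewrite mxE lz.
Qed.

Variable Phi : ((T -> R[i]) -> R[i]) -> 'rV[R[i]]_M.
Hypothesis isoPhi : linear_iso (dual W) Phi.

Lemma linear_iso_lcomb k (c : 'I_k -> R[i]) (l : 'I_k -> (T -> R[i]) -> R[i]) :
  (forall i, dual W (l i)) -> Phi (lcomb c l) = \sum_i c i *: Phi (l i).
Proof.
move=> dl; have [Phi1 _ _] := isoPhi; have [d0 dlin] := subspace_dual.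
have Phi0 : Phi 0 = 0.
  have := Phi1 1 0 0 d0 d0.
  rewrite (_ : (fun _ => _) = 0); last first.
    by apply/funext => t /=; rewrite mulr0 addr0.
  by rewrite scale1r => /eqP; rewrite -subr_eq subrr => /eqP <-.
rewrite /lcomb.
suff H (r : seq 'I_k) : dual W (fun t => \sum_(i <- r) c i * l i t) /\
    Phi (fun t => \sum_(i <- r) c i * l i t) = \sum_(i <- r) c i *: Phi (l i).
  exact: (H (index_enum _)).2.
elim: r => [|i r [IH1 IH2]].
  rewrite (_ : (fun _ => _) = 0) ?big_nil //.
  by apply/funext => t; rewrite big_nil.
rewrite (_ : (fun _ => _) = fun t => c i * l i t + \sum_(j <- r) c j * l j t).
  by split; [exact: dlin|rewrite Phi1 // IH2 big_cons].
by apply/funext => t; rewrite big_cons.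
Qed.

End Dual.

Section Evaluation.
Context {R : realType} {X : topologicalType} {W : set (X -> R[i])} {M : nat}.
Hypothesis subW : subspace W.

Lemma dual_evaluation x : dual W (evaluation W x).
Proof.
have [_ Wlin] := subW; split=> [a h k Wh Wk|h Wh]; rewrite /evaluation.
  by rewrite !asboolT //; exact: Wlin.
by rewrite asboolF.
Qed.

Variable Phi : ((X -> R[i]) -> R[i]) -> 'rV[R[i]]_M.
Hypothesis isoPhi : linear_iso (dual W) Phi.

(** Writing [evaluation W x = \sum_i s_i(x) l_i] in the basis [l] dual to [s]
    exhibits each coordinate as a combination of the [s_i]. *)
Lemma evaluation_coord_in j :
  has_dim W M -> W (fun x => Phi (evaluation W x) 0 j).
Proof.
move=> [s sW].
have Ws i : W (s i) by case: sW => _ <-; apply: sub_cspan; exists i.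
have /choice[l hl] : forall i : 'I_M,
    exists l, dual W l /\ forall j, l (s j) = (i == j)%:R.
  move=> i; have [l dl lz] := dual_exists subW sW (fun j => (i == j)%:R).
  by exists l.
have dl i := (hl i).1.
have ev x : evaluation W x = lcomb (fun i => s i x) l.
  apply: (dual_ext subW sW) => [||k]; first exact: dual_evaluation.
    exact: subspace_lcomb subspace_dual dl.
  rewrite /evaluation asboolT // /lcomb (bigD1 k) //= (hl k).2 eqxx mulr1.
  by rewrite big1 ?addr0 // => i /negbTE ik; rewrite (hl i).2 ik mulr0.
have := subspace_lcomb (fun i => Phi (l i) 0 j) subW Ws.
congr W; apply/funext => x.
rewrite ev (linear_iso_lcomb isoPhi) // summxE /lcomb.
by apply: eq_bigr => i _; rewrite mxE mulrC.
Qed.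

(** Conversely [evaluation W x = \sum_k (Phi (evaluation W x))_k l_k] where
    [Phi l_k] is the [k]-th unit vector. *)
Lemma evaluation_coord_span h : W h ->
  exists c : 'I_M -> R[i],
    forall x, h x = \sum_k c k * Phi (evaluation W x) 0 k.
Proof.
move=> Wh; have [_ inj surj] := isoPhi.
have /choice[l hl] : forall k : 'I_M, exists l, dual W l /\ Phi l = delta_mx 0 k.
  by move=> k; have [l dl lk] := surj (delta_mx 0 k); exists l.
have dl i := (hl i).1.
exists (fun k => l k h) => x; set z := Phi (evaluation W x).
have -> : h x = evaluation W x h by rewrite /evaluation asboolT.
have -> : evaluation W x = lcomb (fun k => z 0 k) l.
  apply: inj; first exact: dual_evaluation.
    exact: subspace_lcomb subspace_dual dl.
  rewrite (linear_iso_lcomb isoPhi) // -/z {1}[z]row_sum_delta.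
  by apply: eq_bigr => k _; rewrite (hl k).2.
by rewrite /lcomb; apply: eq_bigr => k _; rewrite mulrC.
Qed.

End Evaluation.

(** * Translates of Fourier components *)

Section Haar.
Context {R : realType} {G : topGroupType}.
Hypothesis G_compact : compact [set: G].
Variable mu : probability (@borel_type G) R.
Implicit Types (phi psi : G -> R) (u v : G -> R[i]).

Lemma continuous_borel_measurable phi : continuous phi ->
  measurable_fun [set: @borel_type G] (phi : @borel_type G -> R).
Proof.
move=> /continuousP cphi.
apply: (measurability _ (RGenOpens.measurableE R)).
move=> _ [_ [a [b ->] <-]]; rewrite setTI.
by apply: sub_sigma_algebra; exact/cphi/interval_open.
Qed.

Lemma continuous_haar_integrable phi : continuous phi ->
  mu.-integrable setT (EFin \o (phi : @borel_type G -> R)).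
Proof.
move=> cphi; apply: measurable_bounded_integrable => //.
- by rewrite -ge0_fin_numE ?measure_ge0 //; exact: fin_num_measure.
- exact: continuous_borel_measurable.
- have cphi' : {within [set: G], continuous phi} by exact: continuous_subspaceT.
  have /compact_bounded[M [_ hM]] := continuous_compact cphi' G_compact.
  exists M; split; rewrite ?num_real // => B MB g _ /=.
  by apply: (hM B MB); exists g.
Qed.

(** The preimage of [E] under right translation by [h] is [E h^-1], so that the
    image of [mu] under this translation is [mu]. *)
Lemma haar_Rintegral_translate phi h :
  haar_measure mu -> (forall h : G, continuous (fun g : G => (g * h)%g)) ->
  continuous phi ->
  \int[mu]_g phi ((g : G) * h)%g = \int[mu]_g phi g.
Proof.
move=> mu_haar ctr cphi; rewrite /Rintegral; congr fine.
pose tr : @borel_type G -> @borel_type G := fun g => ((g : G) * h)%g.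
have mtr : measurable_fun [set: @borel_type G] tr.
  apply: (@measurability _ _ (@borel_type G) (@borel_type G) setT tr open) => //.
  move=> _ [U oU <-]; rewrite setTI; apply: sub_sigma_algebra.
  by have /continuousP := ctr h; apply.
have ctr_phi : continuous (fun g : G => phi (g * h)%g).
  by move=> g; apply: (@continuous_comp _ _ _ (fun g : G => (g * h)%g) phi);
     [exact: ctr|exact: cphi].
have /measurable_EFinP mphi := continuous_borel_measurable cphi.
have := @integral_pushforward _ _ _ _ _ _ mtr mu setT _ mphi
  (continuous_haar_integrable ctr_phi) measurableT.
rewrite preimage_setT => <-.
apply: eq_measure_integral => E mE _ /=; rewrite /pushforward.
have -> : tr @^-1` E = [set (g * h^-1 : G)%g | g in E].
  apply/seteqP; split => [g Eg|_ [g Eg <-]]; last by rewrite /tr /= mulgVK.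
  by exists (g * h)%g; rewrite ?mulgK.
by have [_ ->] := mu_haar E (h^-1)%g mE.
Qed.

Definition ccontinuous u : Prop :=
  continuous (fun g => complex.Re (u g) : R) /\
  continuous (fun g => complex.Im (u g) : R).

Lemma ccontinuousD u v : ccontinuous u -> ccontinuous v ->
  ccontinuous (fun g => u g + v g).
Proof.
move=> [u1 u2] [v1 v2]; split=> g.
- rewrite (_ : (fun _ => _) = fun g => complex.Re (u g) + complex.Re (v g)).
    by apply: continuousD; [exact: u1|exact: v1].
  by apply/funext => k; rewrite ReD.
- rewrite (_ : (fun _ => _) = fun g => complex.Im (u g) + complex.Im (v g)).
    by apply: continuousD; [exact: u2|exact: v2].
  by apply/funext => k; rewrite ImD.
Qed.

Lemma ccontinuousM u v : ccontinuous u -> ccontinuous v ->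
  ccontinuous (fun g => u g * v g).
Proof.
move=> [u1 u2] [v1 v2]; split=> g.
- rewrite (_ : (fun _ => _) = fun g => complex.Re (u g) * complex.Re (v g) -
    complex.Im (u g) * complex.Im (v g)).
    exact: (continuousB (continuousM (u1 g) (v1 g)) (continuousM (u2 g) (v2 g))).
  by apply/funext => k; rewrite ReM.
- rewrite (_ : (fun _ => _) = fun g => complex.Re (u g) * complex.Im (v g) +
    complex.Im (u g) * complex.Re (v g)).
    exact: (continuousD (continuousM (u1 g) (v2 g)) (continuousM (u2 g) (v1 g))).
  by apply/funext => k; rewrite ImM.
Qed.

Lemma ccontinuous_conj u : ccontinuous u -> ccontinuous (fun g => (u g)^*%C).
Proof.
move=> [u1 u2]; split=> g.
- rewrite (_ : (fun _ => _) = fun g => complex.Re (u g)); first exact: u1.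
  by apply/funext => k; rewrite Re_conj.
- rewrite (_ : (fun _ => _) = fun g => - complex.Im (u g)).
    by apply: continuousN; exact: u2.
  by apply/funext => k; rewrite Im_conj.
Qed.

Lemma ccontinuous_cst a : ccontinuous (fun=> a).
Proof. by split=> g; exact: cvg_cst. Qed.

Lemma ccontinuous_sum I (r : seq I) (w : I -> G -> R[i]) :
  (forall i, ccontinuous (w i)) -> ccontinuous (fun g => \sum_(i <- r) w i g).
Proof.
move=> cw; elim: r => [|i r IH].
  rewrite (_ : (fun _ => _) = fun=> 0); first exact: ccontinuous_cst.
  by apply/funext => g; rewrite big_nil.
rewrite (_ : (fun _ => _) = fun g => w i g + \sum_(j <- r) w j g).
  exact: ccontinuousD.
by apply/funext => g; rewrite big_cons.
Qed.

Lemma cintegralD u v : ccontinuous u -> ccontinuous v ->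
  cintegral mu (fun g => u g + v g) = cintegral mu u + cintegral mu v.
Proof.
move=> [u1 u2] [v1 v2]; rewrite /cintegral.
under eq_Rintegral do rewrite ReD.
under [in X in (_ +i* X)%C]eq_Rintegral do rewrite ImD.
by rewrite !RintegralD //; exact: continuous_haar_integrable.
Qed.

Lemma cintegralZ a u : ccontinuous u ->
  cintegral mu (fun g => a * u g) = a * cintegral mu u.
Proof.
move=> [u1 u2]; rewrite /cintegral.
have cz (r : R) phi : continuous phi -> continuous (fun g => r * phi g).
  by move=> cphi g; apply: continuousM; [exact: cvg_cst|exact: cphi].
under eq_Rintegral do rewrite ReM.
under [in X in (_ +i* X)%C]eq_Rintegral do rewrite ImM.
rewrite RintegralB ?RintegralD ?RintegralZl //;
  try by apply: continuous_haar_integrable => //; exact: cz.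
by case: a.
Qed.

Lemma cintegral_sum (I : Type) (r : seq I) (a : I -> R[i]) (w : I -> G -> R[i]) :
  (forall i, ccontinuous (w i)) ->
  cintegral mu (fun g => \sum_(i <- r) a i * w i g) =
  \sum_(i <- r) a i * cintegral mu (w i).
Proof.
move=> cw; have cZ i : ccontinuous (fun g => a i * w i g).
  by apply: ccontinuousM => //; exact: ccontinuous_cst.
elim: r => [|i r IH].
  rewrite big_nil (_ : (fun _ => _) = fun g => 0 * 0).
    by rewrite (@cintegralZ 0 (fun=> 0)) ?mul0r //; exact: ccontinuous_cst.
  by apply/funext => g; rewrite big_nil mul0r.
rewrite big_cons -IH -cintegralZ // -cintegralD //; last exact: ccontinuous_sum.
by congr cintegral; apply/funext => g; rewrite big_cons.
Qed.

Lemma cintegral_translate u h :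
  haar_measure mu -> (forall h : G, continuous (fun g : G => (g * h)%g)) ->
  ccontinuous u ->
  cintegral mu (fun g => u (g * h)%g) = cintegral mu u.
Proof.
move=> mu_haar ctr [u1 u2]; rewrite /cintegral.
by rewrite (haar_Rintegral_translate h mu_haar ctr u1)
  (haar_Rintegral_translate h mu_haar ctr u2).
Qed.

End Haar.

Lemma cspan_union (R : realType) (T : Type) (I : finType)
    (S : I -> set (T -> R[i])) :
  (forall i, exists K (e : 'I_K -> T -> R[i]), S i `<=` cspan (range e)) ->
  exists K (e : 'I_K -> T -> R[i]), forall i, S i `<=` cspan (range e).
Proof.
move=> hS; pose K i := projT1 (cid (hS i)).
pose e i : 'I_(K i) -> T -> R[i] := projT1 (cid (projT2 (cid (hS i)))).
have he i : S i `<=` cspan (range (e i)) := projT2 (cid (projT2 (cid (hS i)))).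
pose J := {i : I & 'I_(K i)}.
exists #|{: J}|, (fun j => e (tag (enum_val j : J)) (tagged (enum_val j : J))).
move=> i h /he.
apply: cspan_min; first exact: subspace_cspan.
move=> _ [a _ <-]; apply: sub_cspan.
by exists (enum_rank (existT _ i a : J)) => //; rewrite enum_rankK.
Qed.

Section FiniteOrbit.
Context {R : realType} {G : topGroupType} {X : topologicalType} {m : nat}.
Variables (A : set (chart R X m)) (act : G -> X -> X).
Hypothesis G_compact : compact [set: G].
Hypothesis mul_cont : forall h : G, continuous (fun g : G => (g * h)%g).
Hypothesis hA : smooth_atlas A.
Hypothesis act_cont : forall x, continuous (act^~ x).
Hypothesis actM : forall g h x, act (g * h)%g x = act g (act h x).
Variable mu : probability (@borel_type G) R.
Hypothesis mu_haar : haar_measure mu.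

Definition matrix_coefficient k (rho : G -> 'M[R[i]]_k) (u : X -> R[i])
    (ab : 'I_k * 'I_k) : X -> R[i] :=
  fun x => cintegral mu (fun g => u (act g x) * ((rho g ab.1 ab.2)^*)%C).

(** By invariance of the measure, translating a Fourier component by [h]
    replaces [tr (rho g)] by [tr (rho (g h))], which is
    [\sum_(a, b) rho_ab(g) rho_ba(h)]; the dependence on [h] is thus confined to
    the coefficients. *)
Lemma translate_fourier_component k (rho : G -> 'M[R[i]]_k) (u : X -> R[i]) h :
  irreducible_unitary_rep rho -> smooth_fun A u ->
  translate act h (fourier_component act mu rho u) = fun x =>
  \sum_(ab : 'I_k * 'I_k) (k%:R * ((rho h ab.2 ab.1)^*)%C) *
                          matrix_coefficient rho u ab x.
Proof.
move=> [_ [rho1 rhoM] _ rho_cont _] su; apply/funext => x.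
have cu : ccontinuous (fun g => u (act g x)).
  have [u1 u2] := smooth_continuous hA su.
  split=> g.
  - by apply: (@continuous_comp _ _ _ (act^~ x) (fun y => complex.Re (u y) : R));
      [exact: act_cont|exact: u1].
  - by apply: (@continuous_comp _ _ _ (act^~ x) (fun y => complex.Im (u y) : R));
      [exact: act_cont|exact: u2].
have crho a b : ccontinuous (fun g => rho g a b) by exact: rho_cont.
have cterm (ab : 'I_k * 'I_k) :
    ccontinuous (fun g => u (act g x) * ((rho g ab.1 ab.2)^*)%C).
  by apply: ccontinuousM => //; exact: ccontinuous_conj.
have trE g : ((\tr (rho (g * h)%g))^*)%C =
    \sum_(ab : 'I_k * 'I_k)
       ((rho h ab.2 ab.1)^*)%C * ((rho g ab.1 ab.2)^*)%C.
  rewrite rhoM -(pair_bigA _ (fun a b => ((rho h b a)^*)%C * ((rho g a b)^*)%C)).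
  rewrite /mxtrace rmorph_sum; apply: eq_bigr => a _.
  rewrite mxE rmorph_sum; apply: eq_bigr => b _.
  by rewrite rmorphM mulrC.
rewrite /translate /fourier_component.
under eq_bigr => ab _ do rewrite -mulrA.
rewrite -mulr_sumr -(cintegral_sum G_compact mu _ _ cterm); congr (_ * _).
pose F g := u (act g x) * ((\tr (rho (g * h)%g))^*)%C.
have FE : F = fun g => \sum_(ab : 'I_k * 'I_k)
    ((rho h ab.2 ab.1)^*)%C * (u (act g x) * ((rho g ab.1 ab.2)^*)%C).
  apply/funext => g; rewrite /F trE mulr_sumr; apply: eq_bigr => ab _.
  by rewrite mulrCA.
have cF : ccontinuous F.
  rewrite FE; apply: ccontinuous_sum => ab.
  by apply: ccontinuousM => //; exact: ccontinuous_cst.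
rewrite -FE -(cintegral_translate G_compact h^-1 mu_haar mul_cont cF).
congr cintegral; apply/funext => g.
by rewrite /F mulgVK actM.
Qed.

Lemma finite_orbit dm (Rm : forall m, G -> 'M[R[i]]_(dm m)) f :
  (forall m, irreducible_unitary_rep (Rm m)) -> G_finite A act mu Rm f ->
  exists K (e : 'I_K -> X -> R[i]),
    [set translate act g f | g in setT] `<=` cspan (range e).
Proof.
move=> irr [_ [k [mj [w [isow ->]]]]].
have [|K [e he]] := @cspan_union R X 'I_k
    (fun j => [set translate act g (w j) | g in setT]).
  move=> j; have [u su <-] := isow j.
  set I := ('I_(dm (mj j)) * 'I_(dm (mj j)))%type.
  exists #|{: I}|, (fun i => matrix_coefficient (Rm (mj j)) u (enum_val i)).
  move=> _ [g _ <-]; rewrite translate_fourier_component //.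
  apply: subspace_sum; first exact: subspace_cspan.
  move=> ab; apply: sub_cspan.
  by exists (enum_rank (ab : I)) => //; rewrite enum_rankK.
exists K, e => _ [g _ <-].
have := subspace_sum (index_enum 'I_k) (fun=> 1) (subspace_cspan _)
  (fun j => he j _ (ex_intro2 _ _ g I erefl)).
congr cspan; apply/funext => x; rewrite /translate.
by apply: eq_bigr => j _; rewrite mul1r.
Qed.

Lemma orbit_span_has_dim dm (Rm : forall m, G -> 'M[R[i]]_(dm m)) N
    (f : 'I_N -> X -> R[i]) :
  (forall m, irreducible_unitary_rep (Rm m)) ->
  (forall j, G_finite A act mu Rm (f j)) ->
  exists M, has_dim (orbit_span act f) M.
Proof.
move=> irr ff.
have [|K [e he]] := @cspan_union R X 'I_N
    (fun j => [set translate act g (f j) | g in setT]).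
  by move=> j; exact: finite_orbit irr (ff j).
apply: (@has_dim_sub _ _ K e); first exact: subspace_cspan.
apply: cspan_min; first exact: subspace_cspan.
by move=> _ [g _ [j _ <-]]; apply: he; exists g.
Qed.

End FiniteOrbit.

(** * Tangent vectors and CR functions *)

Section TangentVectors.
Context {R : realType} {X : topologicalType} {m : nat}.
Variable A : set (chart R X m).
Hypothesis hA : smooth_atlas A.

Lemma subspace_ctangent x : subspace (ctangent A x).
Proof.
split.
  split=> [a f g _ _|f g _ _|f _] /=; first by rewrite mulr0 addr0.
    by rewrite mulr0 mul0r addr0.
  by [].
move=> a v w [v1 v2 v3] [w1 w2 w3]; split=> [b f g sf sg|f g sf sg|f nf].
- by rewrite v1 // w1 //; ring.
- by rewrite v2 // w2 //; ring.
- by rewrite v3 // w3 // mulr0 addr0.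
Qed.

Lemma ctangent0 x v : ctangent A x v -> v (fun=> 0) = 0.
Proof.
move=> [v1 _ _].
have s0 := smooth_cst (A := A) (0 : R[i]).
have := v1 1 _ _ s0 s0; rewrite (_ : (fun _ => _) = fun=> 0); last first.
  by apply/funext => y; rewrite mulr0 addr0.
by rewrite mul1r => /eqP; rewrite -subr_eq subrr => /eqP <-.
Qed.

Lemma vconj_lin x v a f g : ctangent A x v -> smooth_fun A f -> smooth_fun A g ->
  vconj v (fun y => a * f y + g y) = a * vconj v f + vconj v g.
Proof.
move=> [v1 _ _] sf sg; rewrite /vconj.
rewrite (_ : (fun _ => _) = fun y => (a^*)%C * ((f y)^*)%C + ((g y)^*)%C).
  by rewrite v1; [rewrite rmorphD rmorphM /= conjcK|exact: smooth_conj..].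
by apply/funext => y; rewrite rmorphD rmorphM.
Qed.

Lemma vconj0 x v : ctangent A x v -> vconj v (fun=> 0) = 0.
Proof.
move=> tv; rewrite /vconj (_ : (fun _ => _) = fun=> 0).
  by rewrite (ctangent0 tv) conjc0.
by apply/funext => y; rewrite conjc0.
Qed.

Lemma pushforward_ctangent (Y : topologicalType) (p : nat)
    (B : set (chart R Y p)) (f : X -> Y) x v :
  smooth_atlas B -> smooth_map A B f ->
  ctangent A x v -> ctangent B (f x) (Defs.pushforward B f v).
Proof.
move=> hB sf [v1 v2 v3]; rewrite /Defs.pushforward.
have comp u : smooth_fun B u -> smooth_fun A (u \o f).
  exact: smooth_fun_comp hA hB sf.
split=> [a g h sg sh|g h sg sh|g ng].
- rewrite !asboolT //; last exact: smooth_lin.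
  by rewrite -v1 //; exact: comp.
- rewrite !asboolT //; last exact: smooth_mul.
  by rewrite -[f x]/(f x) -v2 //; exact: comp.
- by rewrite asboolF.
Qed.

Lemma subspace_fiber n (E : X -> set ((X -> R[i]) -> R[i])) x :
  complex_subbundle A n E -> subspace (E x).
Proof.
move=> /(_ x)[U [Z [_ Ux _ /(_ _ Ux)[_ <-]]]]; exact: subspace_cspan.
Qed.

Lemma fiber_ctangent n (E : X -> set ((X -> R[i]) -> R[i])) x :
  complex_subbundle A n E -> E x `<=` ctangent A x.
Proof.
move=> /(_ x)[U [Z [_ Ux sZ /(_ _ Ux)[_ <-]]]].
apply: cspan_min; first exact: subspace_ctangent.
by move=> _ [i _ <-]; have [] := sZ i.
Qed.

(** A vector is extended by the constant-coefficient combination of a local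
    frame, multiplied by a cutoff function. *)
Lemma exists_section n (E : X -> set ((X -> R[i]) -> R[i])) x v :
  smooth_manifold A -> complex_subbundle A n E -> E x v ->
  exists2 Z, bundle_section A E Z & Z x = v.
Proof.
move=> mA hE Ev; have [U [Z [oU Ux sZ bZ]]] := hE x.
have [rho [srho rhox rho0]] := smooth_bump mA oU Ux.
have [c hc] : exists c, v = lcomb c (fun i => Z i x).
  have [_ Ex] := bZ x Ux; move: Ev; rewrite -Ex cspan_range => -[c _ <-].
  by exists c.
pose Y y := lcomb (fun i => rho y / rho x * c i) (fun i => Z i y).
exists Y; last first.
  rewrite /Y hc /lcomb; apply/funext => u.
  by under eq_bigr do rewrite divff // mul1r.
have tY y : ctangent A y (Y y).
  apply: subspace_lcomb; first exact: subspace_ctangent.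
  by move=> i; have [] := sZ i.
split; first split=> // u su.
- rewrite /Y /lcomb; apply: smooth_sum => // i.
  apply: smooth_mul => //; last by have [_] := sZ i; exact.
  by do 2![apply: smooth_mul => //; last exact: smooth_cst].
- move=> y; have [Uy|Uy] := pselect (U y).
    apply: subspace_lcomb; first exact: subspace_fiber hE.
    by move=> i; have [_ <-] := bZ y Uy; apply: sub_cspan; exists i.
  rewrite /Y rho0 // (_ : lcomb _ _ = 0).
    by have [] := subspace_fiber y hE.
  by apply/funext => u; rewrite /lcomb big1 // => i _; rewrite !mul0r.
Qed.

End TangentVectors.

Section CRFunctions.
Context {R : realType} {X : topologicalType} {m : nat}.
Variable A : set (chart R X m).
Hypothesis mA : smooth_manifold A.
Variable T10 : X -> set ((X -> R[i]) -> R[i]).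

Let hA : smooth_atlas A. Proof. by case: mA. Qed.

Lemma subspace_CR : subspace (CR_function A T10).
Proof.
split.
  split=> [|Z [[tZ _] _] x]; first exact: smooth_cst.
  exact: vconj0 (tZ x).
move=> a f g [sf hf] [sg hg]; split; first exact: smooth_lin.
move=> Z hZ x; have [[tZ _] _] := hZ.
by rewrite (vconj_lin hA a (tZ x) sf sg) hf // hg // mulr0 addr0.
Qed.

(** Passage from sections, which define CR functions, to single vectors. *)
Lemma CR_conj_eq0 n h x v : complex_subbundle A n T10 ->
  CR_function A T10 h -> T10 x v -> v (fun y => (h y)^*%C) = 0.
Proof.
move=> hT [_ hh] Tv; have [Z sZ <-] := exists_section hA mA hT Tv.
by apply/eqP; rewrite -conjc_eq0; apply/eqP/hh.
Qed.

(** For a CR diffeomorphism [phi] with inverse [psi], pushing sections of [T10]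
    forward by [phi] gives sections, on which [f] may be tested. *)
Lemma CR_comp (phi psi : X -> X) f :
  smooth_map A A phi -> smooth_map A A psi -> cancel phi psi -> cancel psi phi ->
  (forall x v, T10 x v -> T10 (phi x) (Defs.pushforward A phi v)) ->
  CR_function A T10 f -> CR_function A T10 (f \o phi).
Proof.
move=> sphi spsi phiK psiK Tphi [sf hf]; split.
  exact: smooth_fun_comp hA hA sphi sf.
move=> Z [[tZ sZ] TZ] x.
pose Y y := Defs.pushforward A phi (Z (psi y)).
have sY : bundle_section A T10 Y.
  split; last by move=> y; rewrite -{1}(psiK y); exact: Tphi.
  split=> [y|u su].
    by rewrite -{1}(psiK y); exact: pushforward_ctangent (tZ _).
  rewrite /Y /Defs.pushforward asboolT //.
  apply: (@smooth_fun_comp _ _ _ _ _ A A psi (fun x => Z x (u \o phi))) => //.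
  by apply: sZ; exact: smooth_fun_comp hA hA sphi su.
have := hf Y sY (phi x).
by rewrite /vconj /Y phiK /Defs.pushforward asboolT //; exact: smooth_conj.
Qed.

End CRFunctions.

(** * The action on the orbit span and its dual *)

Section Translations.
Context {R : realType} {G : topGroupType} {X : topologicalType}.
Variable act : G -> X -> X.
Hypothesis act1 : forall x, act 1%g x = x.
Hypothesis actM : forall g h x, act (g * h)%g x = act g (act h x).
Implicit Types (g : G) (f : X -> R[i]).

Lemma actK g : cancel (act g) (act g^-1%g).
Proof. by move=> x; rewrite -actM mulVg act1. Qed.

Lemma actVK g : cancel (act g^-1%g) (act g).
Proof. by move=> x; rewrite -actM mulgV act1. Qed.

Lemma translateM g (h : G) f : translate act g (translate act h f) =
  translate act (g * h)%g f.
Proof. by apply/funext => x; rewrite /translate invgM actM. Qed.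

Lemma translate1 f : translate act 1%g f = f.
Proof. by apply/funext => x; rewrite /translate invg1 act1. Qed.

Variables (N : nat) (f : 'I_N -> X -> R[i]).
Let W := orbit_span act f.

Lemma orbit_span_gen j : W (f j).
Proof.
by apply: sub_cspan; exists 1%g => //; exists j; rewrite // translate1.
Qed.

Lemma orbit_span_translate g h : W h -> W (translate act g h).
Proof.
have subW : subspace W by exact: subspace_cspan.
apply: (@cspan_min _ _ _ [set h | W (translate act g h)]); last first.
  move=> _ [k _ [j _ <-]] /=; rewrite translateM.
  by apply: sub_cspan; exists (g * k)%g => //; exists j.
by split=> [|a u v Wu Wv]; [exact: subW.1|exact: subW.2].
Qed.

Lemma dual_translate_closed g l : dual W l -> dual W (dual_translate act g l).
Proof.
move=> [l1 l2]; split=> [a h k Wh Wk|h Wh]; rewrite /dual_translate.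
  by rewrite -l1 //; apply: orbit_span_translate.
apply: l2 => /(orbit_span_translate g).
by rewrite translateM mulgV translate1.
Qed.

Lemma evaluation_equivariant g x :
  evaluation W (act g x) = dual_translate act g (evaluation W x).
Proof.
apply/funext => h; rewrite /dual_translate /evaluation.
have -> : W (translate act g^-1%g h) = W h.
  apply/propext; split=> [/(orbit_span_translate g)|]; last first.
    exact: orbit_span_translate.
  by rewrite translateM mulgV translate1.
by rewrite /translate invgK.
Qed.

End Translations.

(** * Smooth embeddings and linear factors *)

Section LinearFactor.
Context {R : realType} {M N : nat}.

Lemma zcoord_realify (z : 'rV[R[i]]_M) j : zcoord j (realify z) = z 0 j.
Proof. by rewrite /zcoord row_mxEl row_mxEr !mxE; case: (z 0 j). Qed.

Lemma smooth_zcoord j : smooth_fun (Cspace M) (@zcoord R M j).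
Proof. by move=> _ ->; split=> k; exact: Ck_coord. Qed.

Definition real_linear_map (c : 'I_N -> 'I_M -> R[i]) :
    'rV[R]_(M + M) -> 'rV[R]_(N + N) :=
  fun p => realify (\row_j \sum_k c j k * zcoord k p).

Lemma smooth_real_linear_map c :
  smooth_map (Cspace M) (Cspace N) (real_linear_map c).
Proof.
have hC := @Cspace_atlas R M.
apply: smooth_map_realify => // j; apply: smooth_sum => // k.
by apply: smooth_mul => //; [exact: smooth_cst|exact: smooth_zcoord].
Qed.

End LinearFactor.

(** A tangent vector killed by [f] is killed by [L \o f], and an open set that is
    the preimage of [V] under [L \o f] is the preimage of [L @^-1` V] under
    [f]. *)
Lemma smooth_embedding_factor (R : realType) (X Y Z : topologicalType)
    (m p q : nat) (A : set (chart R X m)) (B : set (chart R Y p))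
    (C : set (chart R Z q)) (f : X -> Y) (L : Y -> Z) :
  smooth_atlas B -> smooth_atlas C -> smooth_map A B f -> smooth_map B C L ->
  smooth_embedding A C (L \o f) -> smooth_embedding A B f.
Proof.
move=> hB hC sf sL [_ immF [_ injF topF]]; split=> //.
- move=> x v tv fv0; apply: (immF x) => //; apply/funext => u.
  rewrite /Defs.pushforward; case: asboolP => // su.
  have sLu : smooth_fun B (u \o L) by exact: smooth_fun_comp hB hC sL su.
  have := congr1 (fun w => w (u \o L)) fv0.
  by rewrite /Defs.pushforward asboolT.
- split; first by case: sf.
    by move=> x y fxy; apply: injF; rewrite /= fxy.
  move=> U /topF[V oV ->]; exists (L @^-1` V) => //.
  by apply: open_comp => // y _; case: sL => cL _; exact: cL.
Qed.

Theorem lemma1p2 (R : realType) (n d : nat)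
  (X : topologicalType) (A : set (chart R X (2 * n + 1 + d)))
  (G : topGroupType) (B : set (chart R G d))
  (act : G -> X -> X)
  (T10 : X -> set ((X -> R[i]) -> R[i]))
  (T : X -> (X -> R[i]) -> R[i])
  (mu : probability (@borel_type G) R)
  (dm : nat -> nat) (Rm : forall m, G -> 'M[R[i]]_(dm m))
  (N : nat) (f : 'I_N -> X -> R[i])
  (n_ge2 : (2 <= n)%N) (d_ge1 : (1 <= d)%N)
  (X_manifold : smooth_manifold A)
  (X_compact : compact [set: X])
  (X_orientable : orientable A)
  (X_CR : CR_structure A n T10)
  (G_lie : lie_group B)
  (G_compact : compact [set: G])
  (G_action : CR_action B A act T10)
  (T_field : real_smooth_field A T)
  (CTX_decomp : forall x,
     direct_sum4 (ctangent A x)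
       (T10 x) (conj_bundle T10 x) (cspan [set T x])
       (cspan (orbit_directions B A act x)))
  (X_spc : strongly_pseudoconvex B A act T10 T)
  (mu_haar : haar_measure mu)
  (Rm_irreps : complete_irreps Rm)
  (f_CR : forall j, CR_function A T10 (f j))
  (f_Gfinite : forall j, G_finite A act mu Rm (f j))
  (f_embedding : smooth_embedding A (Cspace N)
     (fun x => realify (\row_j f j x))) :
  let W := orbit_span act f in
  let Fhat := evaluation W in
  [/\ W `<=` CR_function A T10 /\
      (forall g h, W h -> W (translate act g h)),
      (forall x, dual W (Fhat x)),
      (forall g l, dual W l -> dual W (dual_translate act g l)),
      (forall g x, Fhat (act g x) = dual_translate act g (Fhat x))
    & exists M : nat,
        [/\ has_dim W M,
            (exists Phi : ((X -> R[i]) -> R[i]) -> 'rV[R[i]]_M,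
               linear_iso (dual W) Phi)
          & forall Phi : ((X -> R[i]) -> R[i]) -> 'rV[R[i]]_M,
              linear_iso (dual W) Phi ->
              CR_map A T10 (Cspace M) (Cspace_T10 M)
                (fun x => realify (Phi (Fhat x))) /\
              smooth_embedding A (Cspace M)
                (fun x => realify (Phi (Fhat x)))]].
Proof.
move=> W Fhat.
have [_ _ hA] := X_manifold; have [hT _ _] := X_CR.
have [[_ _ hB] [mul_cont _] _] := G_lie.
have [[act_smooth act1 actM] actT] := G_action.
have act_map g : smooth_map A A (act g) by exact: smooth_map_slice act_smooth.
have subW : subspace W by exact: subspace_cspan.
have WCR : W `<=` CR_function A T10.
  apply: cspan_min; first exact: subspace_CR.
  move=> _ [g _ [j _ <-]].
  apply: (@CR_comp _ _ _ _ X_manifold T10 (act g^-1%g) (act g)) => //.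
  - exact: actVK.
  - exact: actK.
  - by move=> x v Tv; rewrite -actT; exists v.
have mulr_cont (h : G) : continuous (fun g : G => (g * h)%g).
  move=> g; apply: (@continuous_comp _ _ _ (fun g => (g, h))
    (fun z : G * G => (z.1 * z.2)%g)); last exact: mul_cont.
  by apply: cvg_pair; [exact: cvg_id|exact: cvg_cst].
have actx_cont x : continuous (act^~ x).
  move=> g; apply: (@continuous_comp _ _ _ (fun g => (g, x))
    (fun z : G * X => act z.1 z.2)); last by have [cact _] := act_smooth; exact: cact.
  by apply: cvg_pair; [exact: cvg_id|exact: cvg_cst].
have [irr _ _] := Rm_irreps.
have [M dimW] := orbit_span_has_dim G_compact mulr_cont hA actx_cont actM
  mu_haar irr f_Gfinite.
split.
- by split=> // g h; apply: orbit_span_translate.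
- exact: dual_evaluation.
- by move=> g l; apply: dual_translate_closed.
- by apply: evaluation_equivariant.
exists M; split=> //.
  have [s sW] := dimW; exists (fun l => \row_j l (s j)).
  exact: linear_iso_basis.
move=> Phi isoPhi.
pose u j x := Phi (Fhat x) 0 j.
have Wu j : W (u j) by exact: evaluation_coord_in.
have hatE : (fun x => realify (Phi (Fhat x))) = fun x => realify (\row_j u j x).
  by apply/funext => x; congr realify; apply/rowP => j; rewrite mxE.
have hat_smooth : smooth_map A (Cspace M) (fun x => realify (\row_j u j x)).
  by apply: smooth_map_realify => // j; have [] := WCR _ (Wu j).
have hC k := @Cspace_atlas R k.
rewrite hatE; split.
  split=> // x v Tv; split.
    exact: (pushforward_ctangent hA (hC M) hat_smooth (fiber_ctangent hT Tv)).
  move=> j; rewrite /Defs.pushforward; case: asboolP => // _.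
  rewrite -[RHS](CR_conj_eq0 X_manifold hT (WCR _ (Wu j)) Tv); congr v.
  apply/funext => y.
  have -> // : u j y = zcoord j (realify (\row_j u j y)).
  by rewrite zcoord_realify mxE.
have /choice[c hc] : forall j, exists c : 'I_M -> R[i],
    forall x, f j x = \sum_k c k * u k x.
  move=> j; apply: (evaluation_coord_span subW isoPhi).
  exact: orbit_span_gen.
have FE : (fun x => realify (\row_j f j x)) =
    real_linear_map c \o (fun x => realify (\row_j u j x)).
  apply/funext => x /=; congr realify; apply/rowP => j; rewrite !mxE hc.
  by apply: eq_bigr => k _; rewrite zcoord_realify mxE.
apply: smooth_embedding_factor (smooth_real_linear_map c) _ => //.
by rewrite -FE.
Qed.
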